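(* Let $\mathcal M$ be an elementary extension of the $\mathcal L$-structure $\mathcal Z$, expanded to an $\mathcal L_P$-structure by interpreting the new unary predicate $P$ as an additively random subset $D$ of $M$ which is symmetric ($a\in D\iff -a\in D$). Then the $\mathcal L_P$-theory of $(\mathcal M,D)$ is supersimple of rank $1$: working in a sufficiently saturated model $\mathbb U$ of this theory, every $\mathcal L_P$-formula $\varphi(x,\bar a)$ in a single variable $x$ which divides over a subset $B\subseteq\mathbb U$ is algebraic (has only finitely many realizations).
   Context: $\mathcal L$ is the language of abelian groups $(+,-,0)$ with a constant $1$ and unary predicates $x\equiv_k j$ ($0\le j<k$); $\mathcal Z$ is $\mathbb Z$ with the natural interpretation (congruence modulo $k$); $\mathcal L_P=\mathcal L\cup\{P\}$. A formula $\varphi(x,\bar a)$ divides over $B$ if there is a $B$-indiscernible sequence $(\bar a_n)_{n\in\mathbb N}$ with $\bar a_0=\bar a$ such that $\{\varphi(x,\bar a_n)\}_{n\in\mathbb N}$ is inconsistent. A subset $D\subseteq M$ is additively random if for all $r,r'\in\mathbb N$ and all terms $m_1x+z_1,\ldots,m_rx+z_r$ and $m'_1x+z'_1,\ldots,m'_{r'}x+z'_{r'}$ with all $m_i,m'_j\ge1$ integers, there are an $\mathcal L$-formula $\chi(\bar z,\bar z')$ and a finite set $\partial(\chi)\subseteq\mathbb Z$ such that, for all tuples $\bar b,\bar b'$ in $M$ with $(m_i,b_i)\ne(m'_j,b'_j)$ for all $i,j$: (P1) if $\mathcal M\models\chi(\bar b,\bar b')$ then there are infinitely many $a\in M$ with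 $m_ia+b_i\in D$ for all $i$ and $m'_ja+b'_j\notin D$ for all $j$; (P2) if $\mathcal M\not\models\chi(\bar b,\bar b')$, then $r\ge1$ and there is $k\in\partial(\chi)$ such that for every integer $s\in\{0,\ldots,k-1\}$ some $m_is+b_i\equiv_k0$ (as a first-order statement: $\mathcal M\models\forall\bar y\bar y'((\neg\chi(\bar y,\bar y')\wedge\bigwedge_{i,j}y_i\ne y'_j)\to\bigvee_{k\in\partial(\chi)}\bigwedge_{s<k}\bigvee_{i=1}^r m_is+y_i\equiv_k0))$; (P3) for every $k\in\partial(\chi)$, the set of $x\in D$ with $x\equiv_k0$ is a finite subset of $\mathbb Z$. *)

(* Defs.v *)
From Stdlib Require Import ZArith List Arith.
Import ListNotations.

(* An L-structure: carrier with 0, 1, +, unary -, and the congruence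
   predicates  scong k j x  (meant: x ≡_k j, for 0 <= j < k). *)
Record Lstr := {
  car :> Type;
  s0 : car;
  s1 : car;
  sadd : car -> car -> car;
  sneg : car -> car;
  scong : nat -> nat -> car -> Prop }.

Inductive term : Type :=
  | TVar (n : nat) | TZero | TOne | TAdd (t u : term) | TNeg (t : term).

Inductive form : Type :=
  | FEq (t u : term)
  | FCong (k j : nat) (t : term)
  | FP (t : term)
  | FNot (f : form)
  | FAnd (f g : form)
  | FEx (n : nat) (f : form).

Fixpoint isL (f : form) : Prop :=
  match f with
  | FEq _ _ | FCong _ _ _ => True
  | FP _ => False
  | FNot g | FEx _ g => isL g
  | FAnd g h => isL g /\ isL h
  end.

Fixpoint teval (S : Lstr) (v : nat -> S) (t : term) : S :=
  match t with
  | TVar n => v n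
  | TZero => s0 S
  | TOne => s1 S
  | TAdd t u => sadd S (teval S v t) (teval S v u)
  | TNeg t => sneg S (teval S v t)
  end.

Definition upd (S : Lstr) (v : nat -> S) (n : nat) (a : S) : nat -> S :=
  fun m => if Nat.eqb m n then a else v m.

Fixpoint sat (S : Lstr) (P : S -> Prop) (v : nat -> S) (f : form) : Prop :=
  match f with
  | FEq t u => teval S v t = teval S v u
  | FCong k j t => scong S k j (teval S v t)
  | FP t => P (teval S v t)
  | FNot g => ~ sat S P v g
  | FAnd g h => sat S P v g /\ sat S P v h
  | FEx n g => exists a : S, sat S P (upd S v n a) g
  end.

(* The standard L-structure Z (congruence symbols with k = 0 or j >= k,
   which are not in the language, are interpreted as empty). *)
Definition Zstr : Lstr := {|
  car := Z; s0 := 0%Z; s1 := 1%Z; sadd := Z.add; sneg := Z.opp;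
  scong := fun k j t => (0 < k)%nat /\ (j < k)%nat /\
                        Z.modulo t (Z.of_nat k) = Z.of_nat j |}.

Definition noP (S : Lstr) : S -> Prop := fun _ => False.

(* e : Z -> M is an elementary embedding of L-structures, i.e. M is an
   elementary extension of Z (identifying Z with its image under e). *)
Definition elem_ext (M : Lstr) (e : Z -> M) : Prop :=
  forall (f : form), isL f -> forall v : nat -> Z,
    sat Zstr (noP Zstr) v f <-> sat M (noP M) (fun n => e (v n)) f.

Definition nmul (S : Lstr) (n : nat) (a : S) : S :=
  Nat.iter n (sadd S a) (s0 S).

Definition finite_set {T : Type} (A : T -> Prop) : Prop :=
  exists l : list T, forall x, A x -> In x l.

Definition symmetric_set (M : Lstr) (D : M -> Prop) : Prop :=
  forall a : M, D a <-> D (sneg M a).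

(* valuation for chi(z_1..z_r, z'_1..z'_r'): variables 0..r-1 are z, r..r+r'-1 are z' *)
Definition env_list (S : Lstr) (l : list S) : nat -> S :=
  fun n => nth n l (s0 S).

Definition additively_random (M : Lstr) (e : Z -> M) (D : M -> Prop) : Prop :=
  forall ms ms' : list nat,
    (forall m, In m ms -> (1 <= m)%nat) -> (forall m, In m ms' -> (1 <= m)%nat) ->
    exists (chi : form) (dd : list nat),
      isL chi /\ (forall k, In k dd -> (1 <= k)%nat) /\
      (forall b b' : list M,
         length b = length ms -> length b' = length ms' ->
         (forall i j, (i < length ms)%nat -> (j < length ms')%nat ->
            (nth i ms 0%nat, nth i b (s0 M)) <> (nth j ms' 0%nat, nth j b' (s0 M))) ->
         (sat M (noP M) (env_list M (b ++ b')) chi ->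
            ~ finite_set (fun a : M =>
                (forall i, (i < length ms)%nat ->
                   D (sadd M (nmul M (nth i ms 0%nat) a) (nth i b (s0 M)))) /\
                (forall j, (j < length ms')%nat ->
                   ~ D (sadd M (nmul M (nth j ms' 0%nat) a) (nth j b' (s0 M))))))
         /\
         (~ sat M (noP M) (env_list M (b ++ b')) chi ->
            (1 <= length ms)%nat /\
            exists k, In k dd /\
              forall s, (s < k)%nat -> exists i, (i < length ms)%nat /\
                scong M k 0 (sadd M (nmul M (nth i ms 0%nat * s) (s1 M))
                                    (nth i b (s0 M))))) /\
      (forall k, In k dd ->
         exists l : list Z, forall x : M, D x -> scong M k 0 x ->
           exists z, In z l /\ x = e z).

(* Elementary equivalence of L_P-structures (evaluating all formulas at the
   constant-0 valuation amounts to comparing all sentences). *)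
Definition elem_equiv (M : Lstr) (D : M -> Prop) (U : Lstr) (PU : U -> Prop) : Prop :=
  forall f : form, sat M D (fun _ => s0 M) f <-> sat U PU (fun _ => s0 U) f.

Definition env_x (S : Lstr) (x : S) (a : list S) : nat -> S :=
  fun n => match n with O => x | S m => nth m a (s0 S) end.

Fixpoint strictly_incr (l : list nat) : Prop :=
  match l with
  | [] => True
  | i :: l' => (match l' with [] => True | j :: _ => (i < j)%nat end) /\ strictly_incr l'
  end.

Definition indiscernible (U : Lstr) (PU : U -> Prop) (B : U -> Prop)
    (as_ : nat -> list U) : Prop :=
  forall (psi : form) (c : list U), (forall y, In y c -> B y) ->
  forall is js : list nat, length is = length js ->
    strictly_incr is -> strictly_incr js ->
    (sat U PU (env_list U (concat (map as_ is) ++ c)) psi <->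
     sat U PU (env_list U (concat (map as_ js) ++ c)) psi).

Definition divides (U : Lstr) (PU : U -> Prop) (B : U -> Prop)
    (phi : form) (a : list U) : Prop :=
  exists as_ : nat -> list U,
    as_ 0%nat = a /\ (forall n, length (as_ n) = length a) /\
    indiscernible U PU B as_ /\
    exists N : list nat,
      ~ exists x : U, forall n, In n N -> sat U PU (env_x U x (as_ n)) phi.

Definition algebraic (U : Lstr) (PU : U -> Prop) (phi : form) (a : list U) : Prop :=
  finite_set (fun x : U => sat U PU (env_x U x a) phi).

(* Main.v *)
Require Import Defs.
From Stdlib Require Import ZArith List Bool Lia Classical ClassicalEpsilon Ring.
Import ListNotations.

(** Colour an element [x] of a model of the theory by the truth values of [x = 0],
[N | x] and [x \in N P]. Every formula is determined by the colours, for a single [N], of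
finitely many terms in its variables. To eliminate a quantifier over [a], either [a] solves
one of finitely many equations [m a = t], and substitution works after multiplying everything
by [m], or [a = N y + s] and the conditions on [a] become [m_i y + b_i \in P] and
[m'_j y + b'_j \notin P] together with inequations. Additive randomness then yields infinitely
many [y] unless a congruence obstruction modulo some [k] forces an [m_i y + b_i] into the
finite set of elements of [P] divisible by [k], which is one of the equations above.

For dividing, fix an infinite set of solutions of [phi(x, a_0)] with a given colouring and
apply the same argument to the union of the colour conditions over [a_n] for finitely many [n].
Indiscernible sequences have constant residues, so that an obstruction for the union is already
one for [a_0], contradicting infinity; and a coincidence [b_i(a_n) = b'_j(a_m)] would by
indiscernibility occur already for [n = m = 0]. *)

(** * Formulas, expressible conditions and their transfer between structures *)

Lemma teval_ext (S : Lstr) (v w : nat -> S) (t : term) :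
  (forall n, v n = w n) -> teval S v t = teval S w t.
Proof. intros H; induction t; simpl; congruence. Qed.

Lemma upd_ext (S : Lstr) (v w : nat -> S) (n : nat) (a : S) :
  (forall m, v m = w m) -> forall m, upd S v n a m = upd S w n a m.
Proof. intros H m; unfold upd; destruct (Nat.eqb m n); auto. Qed.

Lemma sat_ext (S : Lstr) (P : S -> Prop) (f : form) : forall v w : nat -> S,
  (forall n, v n = w n) -> (sat S P v f <-> sat S P w f).
Proof.
  induction f; intros v w H; simpl.
  - rewrite (teval_ext S v w t), (teval_ext S v w u) by assumption; tauto.
  - rewrite (teval_ext S v w t) by assumption; tauto.
  - rewrite (teval_ext S v w t) by assumption; tauto.
  - rewrite (IHf v w H); tauto.
  - rewrite (IHf1 v w H), (IHf2 v w H); tauto.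
  - split; intros [a Ha]; exists a;
      apply (IHf (upd S v n a) (upd S w n a) (upd_ext S v w n a H)); assumption.
Qed.

Lemma sat_isL (S : Lstr) (P Q : S -> Prop) (f : form) :
  isL f -> forall v, sat S P v f <-> sat S Q v f.
Proof.
  induction f; simpl; intros HL v; try tauto.
  - rewrite (IHf HL v); tauto.
  - rewrite (IHf1 (proj1 HL) v), (IHf2 (proj2 HL) v); tauto.
  - split; intros [a Ha]; exists a; apply (IHf HL); assumption.
Qed.

Definition FAll (n : nat) (f : form) : form := FNot (FEx n (FNot f)).

Fixpoint FAlls (n : nat) (f : form) : form :=
  match n with O => f | S k => FAll k (FAlls k f) end.

(** Elementary equivalence compares formulas at the zero valuation only. Statements about arbitrary
    parameters are therefore closed over the finitely many variables below [n]. *)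
Lemma sat_FAlls (S : Lstr) (P : S -> Prop) (n : nat) (f : form) : forall v : nat -> S,
  sat S P v (FAlls n f) <->
  forall w : nat -> S, (forall i, (n <= i)%nat -> w i = v i) -> sat S P w f.
Proof.
  induction n as [|n IH]; intros v.
  - split.
    + intros H w Hw. apply (sat_ext S P f v w); [|exact H].
      intros i; symmetry; apply Hw; lia.
    + intros H; apply H; reflexivity.
  - simpl; split.
    + intros H w Hw. apply NNPP; intros Hn. apply H. exists (w n). rewrite IH.
      intros H2. apply Hn, H2. intros i Hi. unfold upd.
      destruct (Nat.eqb_spec i n); [subst; reflexivity|apply Hw; lia].
    + intros H [a Ha]. apply Ha. apply IH. intros w Hw. apply H.
      intros i Hi. rewrite Hw by lia. unfold upd.
      destruct (Nat.eqb_spec i n); [lia|reflexivity].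
Qed.

Lemma isL_FAlls (n : nat) (f : form) : isL f -> isL (FAlls n f).
Proof. induction n; simpl; auto. Qed.

(* With [b = true] the defining formula is required not to mention [P]. *)
Definition expressible (b : bool)
    (R : forall S : Lstr, (S -> Prop) -> (nat -> S) -> Prop) : Prop :=
  exists f, (b = true -> isL f) /\ forall S P v, sat S P v f <-> R S P v.

Lemma expr_eq b t u : expressible b (fun S _ v => teval S v t = teval S v u).
Proof. exists (FEq t u); split; simpl; tauto. Qed.

Lemma expr_cong b k j t : expressible b (fun S _ v => scong S k j (teval S v t)).
Proof. exists (FCong k j t); split; simpl; tauto. Qed.

Lemma expr_P t : expressible false (fun S P v => P (teval S v t)).
Proof. exists (FP t); split; simpl; [discriminate|tauto]. Qed.

Lemma expr_not b R : expressible b R -> expressible b (fun S P v => ~ R S P v).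
Proof.
  intros [f [Hf H]]; exists (FNot f); split; simpl; [exact Hf|].
  intros; rewrite H; tauto.
Qed.

Lemma expr_and b R R' : expressible b R -> expressible b R' ->
  expressible b (fun S P v => R S P v /\ R' S P v).
Proof.
  intros [f [Hf H]] [f' [Hf' H']]; exists (FAnd f f'); split; simpl; [tauto|].
  intros; rewrite H, H'; tauto.
Qed.

Lemma expr_iff b R R' : (forall S P v, R S P v <-> R' S P v) ->
  expressible b R -> expressible b R'.
Proof.
  intros H [f [Hf H']]; exists f; split; [exact Hf|]. intros; rewrite H'; apply H.
Qed.

Lemma expr_imp b R R' : expressible b R -> expressible b R' ->
  expressible b (fun S P v => R S P v -> R' S P v).
Proof.
  intros H H'.
  apply expr_iff with (fun S P v => ~ (R S P v /\ ~ R' S P v)).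
  - intros; split; [intros K r; apply NNPP; tauto|tauto].
  - apply expr_not, expr_and, expr_not; assumption.
Qed.

(** By excluded middle an external proposition is one of two constant formulas. Conditions on
    indices or coefficients can thus stand inside an expressible relation. *)
Lemma expr_const b (Q : Prop) : expressible b (fun _ _ _ => Q).
Proof.
  destruct (classic Q).
  - exists (FEq TZero TZero); simpl; tauto.
  - exists (FNot (FEq TZero TZero)); simpl; tauto.
Qed.

Lemma expr_ex b n R : expressible b R ->
  expressible b (fun S P v => exists a, R S P (upd S v n a)).
Proof.
  intros [f [Hf H]]; exists (FEx n f); split; simpl; [exact Hf|].
  intros; split; intros [a Ha]; exists a; apply H; assumption.
Qed.

Lemma expr_all_in {T} b (l : list T) R : (forall x, In x l -> expressible b (R x)) ->
  expressible b (fun S P v => forall x, In x l -> R x S P v).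
Proof.
  induction l as [|x l IH]; intros H.
  - apply expr_iff with (fun _ _ _ => True); [simpl; tauto|apply expr_const].
  - apply expr_iff with (fun S P v => R x S P v /\ forall y, In y l -> R y S P v).
    + intros; simpl; split; [|intuition]. intros [K1 K2] y [<-|Hy]; auto.
    + apply expr_and; [apply H; simpl; auto|]. apply IH. intros; apply H; simpl; auto.
Qed.

Lemma expr_ex_in {T} b (l : list T) R : (forall x, In x l -> expressible b (R x)) ->
  expressible b (fun S P v => exists x, In x l /\ R x S P v).
Proof.
  intros H. apply expr_iff with (fun S P v => ~ forall x, In x l -> ~ R x S P v).
  - intros; split.
    + intros K; apply NNPP; intros K2; apply K; intros x Hx K3; apply K2; eauto.
    + intros [x [Hx K]] K2; eapply K2; eauto.
  - apply expr_not, expr_all_in. intros; apply expr_not; auto.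
Qed.

(** The universal closure of the defining formula is true in [M], hence in [U]. The closure binds
    only the variables below [n], so valuations have to vanish from [n] on. *)
Lemma elem_equiv_expr (M : Lstr) D (U : Lstr) PU n R :
  elem_equiv M D U PU -> expressible false R ->
  (forall v : nat -> M, (forall i, (n <= i)%nat -> v i = s0 M) -> R M D v) ->
  forall v : nat -> U, (forall i, (n <= i)%nat -> v i = s0 U) -> R U PU v.
Proof.
  intros E [f [_ Hf]] H v Hv. apply Hf.
  assert (K : sat U PU (fun _ => s0 U) (FAlls n f)).
  { apply E, sat_FAlls. intros w Hw; apply Hf, H, Hw. }
  exact (proj1 (sat_FAlls U PU n f _) K v Hv).
Qed.

Lemma elem_ext_zero (M : Lstr) e : elem_ext M e -> e 0%Z = s0 M.
Proof. intros E. apply (E (FEq (TVar 0) TZero) I (fun _ => 0%Z)). reflexivity. Qed.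

(** The same argument along the elementary embedding of Z. As the formula does not mention [P], the
    result holds in [M] whatever [D] is. *)
Lemma elem_ext_expr (M : Lstr) e D n R :
  elem_ext M e -> expressible true R ->
  (forall v : nat -> Zstr, R Zstr (noP Zstr) v) ->
  forall v : nat -> M, (forall i, (n <= i)%nat -> v i = s0 M) -> R M D v.
Proof.
  intros E [f [HL Hf]] H v Hv. apply Hf. specialize (HL eq_refl).
  assert (K : sat M (noP M) (fun _ => e 0%Z) (FAlls n f)).
  { apply (E _ (isL_FAlls n f HL) (fun _ => 0%Z)), sat_FAlls. intros w _; apply Hf, H. }
  apply (sat_isL M D (noP M) f HL). rewrite sat_FAlls in K.
  apply K. intros i Hi. rewrite Hv by assumption. symmetry; exact (elem_ext_zero M e E).
Qed.

Fixpoint tnmul (n : nat) (t : term) : term :=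
  match n with O => TZero | S k => TAdd t (tnmul k t) end.

Lemma teval_tnmul (S : Lstr) v n t : teval S v (tnmul n t) = nmul S n (teval S v t).
Proof. induction n; simpl; [reflexivity|]. rewrite IHn; reflexivity. Qed.

(** * The first-order properties of Z that every model inherits *)

(** Every field is, for fixed [k], [j] and [m], a first-order sentence true in Z. Together they say
    that the group is torsion-free, that congruences are divisibility statements, and that the
    multiples of 1 represent all classes modulo [k]. *)
Record Zgroup (U : Lstr) : Prop := {
  zg_addA : forall x y z : U, sadd U (sadd U x y) z = sadd U x (sadd U y z);
  zg_addC : forall x y : U, sadd U x y = sadd U y x;
  zg_add0 : forall x : U, sadd U (s0 U) x = x;
  zg_addN : forall x : U, sadd U x (sneg U x) = s0 U;
  zg_torsion_free : forall (m : nat) (x : U), (1 <= m)%nat -> nmul U m x = s0 U -> x = s0 U;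
  zg_cong0 : forall (k : nat) (x : U), (1 <= k)%nat ->
    (scong U k 0 x <-> exists y, x = nmul U k y);
  zg_cong : forall (k j : nat) (x : U), scong U k j x <->
    (j < k)%nat /\ scong U k 0 (sadd U x (sneg U (nmul U j (s1 U))));
  zg_residue : forall (k : nat) (x : U), (1 <= k)%nat ->
    exists j, In j (seq 0 k) /\ scong U k j x }.

Lemma nmul_Zstr n (x : Z) : nmul Zstr n x = (Z.of_nat n * x)%Z.
Proof.
  induction n; [reflexivity|].
  change (x + nmul Zstr n x = Z.of_nat (S n) * x)%Z. rewrite IHn. lia.
Qed.

Lemma Zgroup_transfer (M : Lstr) e D (U : Lstr) PU :
  elem_ext M e -> elem_equiv M D U PU -> Zgroup U.
Proof.
  intros E1 E2.
  (* Both transfers are composed: an L-condition valid in Z under every valuation holds at every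
     finite tuple of [U]. [T2] is the version for equivalences. *)
  assert (T : forall R, expressible true R ->
    (forall v : nat -> Zstr, R Zstr (noP Zstr) v) ->
    forall l : list U, R U PU (env_list U l)).
  { intros R HR H l. apply (elem_equiv_expr M D U PU (length l) R E2).
    - destruct HR as [f [_ Hf]]. exists f; split; [discriminate|exact Hf].
    - apply (elem_ext_expr M e D (length l) R E1 HR H).
    - intros i Hi. apply nth_overflow, Hi. }
  assert (T2 : forall R R', expressible true R -> expressible true R' ->
    (forall v : nat -> Zstr, R Zstr (noP Zstr) v <-> R' Zstr (noP Zstr) v) ->
    forall l : list U, R U PU (env_list U l) <-> R' U PU (env_list U l)).
  { intros R R' HR HR' H l.
    apply (T _ (expr_and true _ _ (expr_imp true _ _ HR HR') (expr_imp true _ _ HR' HR))).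
    intros v; apply H. }
  split.
  - intros x y z.
    refine (T _ (expr_eq true (TAdd (TAdd (TVar 0) (TVar 1)) (TVar 2))
      (TAdd (TVar 0) (TAdd (TVar 1) (TVar 2)))) _ [x; y; z]).
    intros v; simpl; lia.
  - intros x y.
    refine (T _ (expr_eq true (TAdd (TVar 0) (TVar 1)) (TAdd (TVar 1) (TVar 0))) _ [x; y]).
    intros v; simpl; lia.
  - intros x.
    refine (T _ (expr_eq true (TAdd TZero (TVar 0)) (TVar 0)) _ [x]).
    intros v; simpl; lia.
  - intros x.
    refine (T _ (expr_eq true (TAdd (TVar 0) (TNeg (TVar 0))) TZero) _ [x]).
    intros v; simpl; lia.
  - intros m x Hm.
    generalize (T _ (expr_imp true _ _ (expr_eq true (tnmul m (TVar 0)) TZero)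
      (expr_eq true (TVar 0) TZero))). cbv beta. intros K.
    specialize (fun H => K H [x]). rewrite teval_tnmul in K.
    apply K. intros v. rewrite teval_tnmul, nmul_Zstr. simpl. nia.
  - intros k x Hk.
    generalize (T2 _ _ (expr_cong true k 0 (TVar 0))
      (expr_ex true 1 _ (expr_eq true (TVar 0) (tnmul k (TVar 1))))).
    cbv beta. intros K. specialize (fun H => K H [x]). simpl in K. rewrite K; clear K.
    + split; intros [a Ha]; exists a; rewrite teval_tnmul in *; exact Ha.
    + intros v; split.
      * intros [_ [_ H]]. exists (v 0%nat / Z.of_nat k)%Z.
        rewrite teval_tnmul, nmul_Zstr. unfold upd; simpl.
        apply Z.div_exact; lia.
      * intros [a Ha]. rewrite teval_tnmul, nmul_Zstr in Ha.
        unfold upd in Ha; simpl in Ha. repeat split; try lia.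
        rewrite Ha, Z.mul_comm. apply Z.mod_mul; lia.
  - intros k j x.
    generalize (T2 _ _ (expr_cong true k j (TVar 0))
      (expr_and true _ _ (expr_const true (j < k)%nat)
        (expr_cong true k 0 (TAdd (TVar 0) (TNeg (tnmul j TOne)))))).
    cbv beta. intros K. specialize (fun H => K H [x]). simpl in K.
    rewrite teval_tnmul in K. apply K. clear K.
    intros v. rewrite teval_tnmul. simpl. rewrite nmul_Zstr.
    replace (v 0%nat + - (Z.of_nat j * 1))%Z with (v 0%nat - Z.of_nat j)%Z by lia.
    split.
    + intros [H1 [H2 H3]]. repeat split; try lia.
      rewrite Zminus_mod, H3, (Z.mod_small (Z.of_nat j)), Z.sub_diag by lia.
      apply Z.mod_0_l; lia.
    + intros [H1 [H2 [H3 H4]]]. repeat split; try lia.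
      replace (v 0%nat) with (v 0%nat - Z.of_nat j + Z.of_nat j)%Z by lia.
      rewrite Zplus_mod, H4, Z.add_0_l, Z.mod_mod by lia.
      apply Z.mod_small; lia.
  - intros k x Hk.
    refine (T _ (expr_ex_in true (seq 0 k)
      (fun j S _ v => scong S k j (teval S v (TVar 0))) _) _ [x]).
    + intros j _; apply expr_cong.
    + intros v. pose proof (Z.mod_pos_bound (v 0%nat) (Z.of_nat k) ltac:(lia)).
      exists (Z.to_nat (v 0%nat mod Z.of_nat k)). rewrite in_seq. simpl.
      repeat split; lia.
Qed.

(** * Torsion-free Z-modules *)

(** One of the two truncations is always 0, so no case distinction on the sign is needed. *)
Definition zmul (U : Lstr) (z : Z) (x : U) : U :=
  sadd U (nmul U (Z.to_nat z) x) (sneg U (nmul U (Z.to_nat (- z)) x)).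

Section Zmodule.

Variable U : Lstr.
Hypothesis HU : Zgroup U.

Local Notation "x ⊕ y" := (sadd U x y) (at level 50, left associativity).
Local Notation "⊖ x" := (sneg U x) (at level 35, right associativity).
Local Notation "z ⊙ x" := (zmul U z x) (at level 40, left associativity).
Local Notation "'O" := (s0 U).

Let addA := zg_addA U HU.
Let addC := zg_addC U HU.
Let add0 := zg_add0 U HU.
Let addN := zg_addN U HU.

Lemma zg_addr0 x : x ⊕ 'O = x.
Proof. rewrite addC; apply add0. Qed.

Lemma zg_cancel x y z : x ⊕ y = x ⊕ z -> y = z.
Proof.
  intros H. rewrite <- (add0 y), <- (add0 z), <- (addN x), (addC x), !addA, H. reflexivity.
Qed.

Lemma zg_addCA x y z : x ⊕ (y ⊕ z) = y ⊕ (x ⊕ z).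
Proof. rewrite <- !addA, (addC x y). reflexivity. Qed.

Lemma zg_addACA x y z t : (x ⊕ y) ⊕ (z ⊕ t) = (x ⊕ z) ⊕ (y ⊕ t).
Proof. rewrite !addA, (zg_addCA y z). reflexivity. Qed.

Lemma zg_opp_unique x y : x ⊕ y = 'O -> y = ⊖ x.
Proof. intros H. apply (zg_cancel x). rewrite H, addN. reflexivity. Qed.

Lemma zg_oppD x y : ⊖ (x ⊕ y) = ⊖ x ⊕ ⊖ y.
Proof.
  symmetry. apply zg_opp_unique. rewrite zg_addACA, !addN. apply add0.
Qed.

Lemma zg_oppK x : ⊖ (⊖ x) = x.
Proof. symmetry. apply zg_opp_unique. rewrite addC; apply addN. Qed.

Lemma zg_opp0 : ⊖ 'O = 'O.
Proof. symmetry; apply zg_opp_unique, add0. Qed.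

Lemma nmulDl m n x : nmul U (m + n) x = nmul U m x ⊕ nmul U n x.
Proof.
  induction m; simpl; [symmetry; apply add0|].
  change (x ⊕ nmul U (m + n) x = (x ⊕ nmul U m x) ⊕ nmul U n x).
  rewrite IHm, addA. reflexivity.
Qed.

Lemma nmulDr n x y : nmul U n (x ⊕ y) = nmul U n x ⊕ nmul U n y.
Proof.
  induction n; simpl; [symmetry; apply add0|].
  change ((x ⊕ y) ⊕ nmul U n (x ⊕ y) = (x ⊕ nmul U n x) ⊕ (y ⊕ nmul U n y)).
  rewrite IHn, zg_addACA. reflexivity.
Qed.

Lemma nmul_zmul n x : nmul U n x = Z.of_nat n ⊙ x.
Proof.
  unfold zmul. rewrite Nat2Z.id.
  replace (Z.to_nat (- Z.of_nat n)) with 0%nat by lia.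
  simpl. rewrite zg_opp0, zg_addr0. reflexivity.
Qed.

Lemma zmulDr a x y : a ⊙ (x ⊕ y) = a ⊙ x ⊕ a ⊙ y.
Proof. unfold zmul. rewrite !nmulDr, zg_oppD. apply zg_addACA. Qed.

Lemma zmulDl a b x : (a + b) ⊙ x = a ⊙ x ⊕ b ⊙ x.
Proof.
  unfold zmul. rewrite zg_addACA, <- zg_oppD, <- !nmulDl.
  (* Adding all subtracted multiples to both sides leaves only natural multiples of [x]. The rest is
     the identity (a+b)⁺ + a⁻ + b⁻ = (a+b)⁻ + a⁺ + b⁺ of truncations. *)
  apply (zg_cancel (nmul U (Z.to_nat (- (a + b)) + (Z.to_nat (- a) + Z.to_nat (- b))) x)).
  rewrite (nmulDl (Z.to_nat (- (a + b)))) at 1.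
  rewrite zg_addACA, (addC (nmul U (Z.to_nat (- (a + b))) x)),
    (zg_addACA _ (nmul U (Z.to_nat (- (a + b))) x)), addN, zg_addr0.
  rewrite (nmulDl (Z.to_nat (- (a + b)))).
  rewrite zg_addACA, addN, zg_addr0, <- !nmulDl. f_equal. lia.
Qed.

Lemma zmul0l x : 0 ⊙ x = 'O.
Proof. unfold zmul; simpl. apply addN. Qed.

Lemma zmul1l x : 1 ⊙ x = x.
Proof.
  unfold zmul. change (Z.to_nat 1) with 1%nat. change (Z.to_nat (-1)) with 0%nat. simpl.
  rewrite zg_opp0, !zg_addr0. reflexivity.
Qed.

Lemma zmulNl a x : (- a) ⊙ x = ⊖ (a ⊙ x).
Proof.
  apply zg_opp_unique. rewrite <- zmulDl, Z.add_opp_diag_r. apply zmul0l.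
Qed.

Lemma zmul0r a : a ⊙ 'O = 'O.
Proof.
  apply (zg_cancel (a ⊙ 'O)). rewrite <- zmulDr, add0, zg_addr0. reflexivity.
Qed.

Lemma zmulA a b x : (a * b) ⊙ x = a ⊙ (b ⊙ x).
Proof.
  revert a. apply Z.peano_ind.
  - rewrite !zmul0l. reflexivity.
  - intros a IH. rewrite Z.mul_succ_l. unfold Z.succ. rewrite !zmulDl, IH, zmul1l.
    reflexivity.
  - intros a IH. replace (Z.pred a * b)%Z with (a * b + - b)%Z by lia.
    unfold Z.pred. rewrite !zmulDl, IH. f_equal.
    replace (-1)%Z with (- (1))%Z by lia. rewrite !zmulNl, zmul1l. reflexivity.
Qed.

(* In the square-zero extension Z ⊕ U every identity between Z-linear expressions
   in U becomes an identity of commutative rings, so that [ring] decides it. *)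
Definition text := (Z * U)%type.
Definition tadd (a b : text) : text := ((fst a + fst b)%Z, snd a ⊕ snd b).
Definition tmul (a b : text) : text :=
  ((fst a * fst b)%Z, fst a ⊙ snd b ⊕ fst b ⊙ snd a).
Definition topp (a : text) : text := ((- fst a)%Z, ⊖ snd a).
Definition tsub (a b : text) : text := tadd a (topp b).
Definition tcst (z : Z) : text := (z, 'O).
Definition temb (x : U) : text := (0%Z, x).

Lemma text_ring : ring_theory (tcst 0) (tcst 1) tadd tmul tsub topp eq.
Proof.
  split.
  - intros [a x]; unfold tadd, tcst; simpl. rewrite add0. reflexivity.
  - intros [a x] [b y]; unfold tadd; simpl. rewrite addC, Z.add_comm. reflexivity.
  - intros [a x] [b y] [c z]; unfold tadd; simpl. rewrite addA, Z.add_assoc. reflexivity.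
  - intros [a x]; unfold tmul, tcst; simpl. rewrite zmul1l, zmul0r, zg_addr0.
    f_equal. destruct a; reflexivity.
  - intros [a x] [b y]; unfold tmul; simpl. rewrite addC, Z.mul_comm. reflexivity.
  - intros [a x] [b y] [c z]; unfold tmul; simpl.
    rewrite !zmulDr, <- !zmulA, Z.mul_assoc, <- addA, (Z.mul_comm c a), (Z.mul_comm c b).
    reflexivity.
  - intros [a x] [b y] [c z]; unfold tmul, tadd; simpl.
    rewrite zmulDl, zmulDr, Z.mul_add_distr_r. f_equal. apply zg_addACA.
  - reflexivity.
  - intros [a x]; unfold tadd, topp, tcst; simpl. rewrite addN. f_equal. lia.
Qed.

Add Ring text_ring : text_ring.

Lemma temb_inj x y : temb x = temb y -> x = y.
Proof. unfold temb; congruence. Qed.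

Lemma tembD x y : temb (x ⊕ y) = tadd (temb x) (temb y).
Proof. reflexivity. Qed.

Lemma tembN x : temb (⊖ x) = topp (temb x).
Proof. reflexivity. Qed.

Lemma temb0 : temb 'O = tcst 0.
Proof. reflexivity. Qed.

Lemma tembZ a x : temb (a ⊙ x) = tmul (tcst a) (temb x).
Proof. unfold temb, tmul, tcst; simpl. rewrite zmul0l, zg_addr0, Z.mul_0_r. reflexivity. Qed.

Lemma tcstD a b : tcst (a + b) = tadd (tcst a) (tcst b).
Proof. unfold tcst, tadd; simpl; rewrite add0; reflexivity. Qed.

Lemma tcstN a : tcst (- a) = topp (tcst a).
Proof. unfold tcst, topp; simpl; rewrite zg_opp0; reflexivity. Qed.

Lemma tcstB a b : tcst (a - b) = tsub (tcst a) (tcst b).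
Proof. unfold Z.sub. rewrite tcstD, tcstN. reflexivity. Qed.

Lemma tcstM a b : tcst (a * b) = tmul (tcst a) (tcst b).
Proof. unfold tcst, tmul; simpl; rewrite !zmul0r, add0; reflexivity. Qed.

Ltac zmodule :=
  apply temb_inj;
  repeat rewrite ?tembD, ?tembN, ?temb0, ?tembZ, ?tcstD, ?tcstN, ?tcstB, ?tcstM;
  ring.

Lemma zg_sub_eq0 x y : x ⊕ ⊖ y = 'O -> x = y.
Proof.
  intros H. replace y with (('O) ⊕ y) by zmodule. rewrite <- H. zmodule.
Qed.

Lemma zmul_eq0 m x : m <> 0%Z -> m ⊙ x = 'O -> x = 'O.
Proof.
  intros Hm H. destruct (Z_lt_le_dec 0 m) as [Hp|Hp].
  - apply (zg_torsion_free U HU (Z.to_nat m)); [lia|].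
    rewrite nmul_zmul, Z2Nat.id by lia. exact H.
  - apply (zg_torsion_free U HU (Z.to_nat (- m))); [lia|].
    rewrite nmul_zmul, Z2Nat.id, zmulNl, H by lia. apply zg_opp0.
Qed.

Lemma zmul_inj m x y : m <> 0%Z -> m ⊙ x = m ⊙ y -> x = y.
Proof.
  intros Hm H. apply zg_sub_eq0, (zmul_eq0 m); [assumption|].
  replace (m ⊙ (x ⊕ ⊖ y)) with (m ⊙ x ⊕ ⊖ (m ⊙ y)) by zmodule. rewrite H. zmodule.
Qed.

Definition zdvd (k : Z) (x : U) : Prop := exists y, x = k ⊙ y.

Lemma scong_zdvd (k : nat) x : (1 <= k)%nat -> (scong U k 0 x <-> zdvd (Z.of_nat k) x).
Proof.
  intros Hk. rewrite (zg_cong0 U HU k x Hk).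
  split; intros [y Hy]; exists y; rewrite nmul_zmul in *; exact Hy.
Qed.

Definition zrange (k : Z) : list Z := map Z.of_nat (seq 0 (Z.to_nat k)).

Lemma in_zrange k s : In s (zrange k) <-> (0 <= s < k)%Z.
Proof.
  unfold zrange. rewrite in_map_iff. split.
  - intros [n [<- Hn]]. apply in_seq in Hn. lia.
  - intros H. exists (Z.to_nat s). rewrite in_seq. lia.
Qed.

Lemma zdvd_residue k x : (1 <= k)%Z -> exists s y, In s (zrange k) /\ x = k ⊙ y ⊕ s ⊙ s1 U.
Proof.
  intros Hk. destruct (zg_residue U HU (Z.to_nat k) x) as [j [Hj H]]; [lia|].
  apply in_seq in Hj. apply (zg_cong U HU) in H. destruct H as [_ H].
  apply scong_zdvd in H; [|lia]. destruct H as [y Hy]. rewrite Z2Nat.id in Hy by lia.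
  exists (Z.of_nat j), y. split; [apply in_zrange; lia|].
  rewrite <- Hy, nmul_zmul. zmodule.
Qed.

Lemma zdvd_scale m k x : m <> 0%Z -> (zdvd (m * k) (m ⊙ x) <-> zdvd k x).
Proof.
  intros Hm; split; intros [y Hy]; exists y.
  - apply (zmul_inj m _ _ Hm). rewrite Hy. zmodule.
  - rewrite Hy. zmodule.
Qed.

Lemma zdvd_add k x y : zdvd k y -> (zdvd k (x ⊕ y) <-> zdvd k x).
Proof.
  intros [y' Hy]. subst y. split; intros [z Hz].
  - exists (z ⊕ ⊖ y'). replace x with ((x ⊕ k ⊙ y') ⊕ ⊖ (k ⊙ y')) by zmodule.
    rewrite Hz. zmodule.
  - exists (z ⊕ y'). rewrite Hz. zmodule.
Qed.

(* Unspecified unless [k] divides [x]. *)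
Definition zquot (k : Z) (x : U) : U := epsilon (inhabits 'O) (fun y => x = k ⊙ y).

Lemma zquot_spec k x : zdvd k x -> x = k ⊙ zquot k x.
Proof. intros H. exact (epsilon_spec (inhabits 'O) (fun y => x = k ⊙ y) H). Qed.

Lemma zquot_mul k y : k <> 0%Z -> zquot k (k ⊙ y) = y.
Proof.
  intros Hk. apply (zmul_inj k _ _ Hk). symmetry. apply zquot_spec. exists y; reflexivity.
Qed.

Fixpoint coef (i : nat) (t : term) : Z :=
  match t with
  | TVar n => if Nat.eqb n i then 1 else 0
  | TZero | TOne => 0
  | TAdd t u => coef i t + coef i u
  | TNeg t => - coef i t
  end.

Fixpoint tdrop (i : nat) (t : term) : term :=
  match t with
  | TVar n => if Nat.eqb n i then TZero else TVar n
  | TZero => TZero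
  | TOne => TOne
  | TAdd t u => TAdd (tdrop i t) (tdrop i u)
  | TNeg t => TNeg (tdrop i t)
  end.

Lemma teval_upd v i a t :
  teval U (upd U v i a) t = coef i t ⊙ a ⊕ teval U v (tdrop i t).
Proof.
  induction t as [n| | |t IHt u IHu|t IHt]; simpl.
  - unfold upd. destruct (Nat.eqb n i); simpl; [rewrite zmul1l|rewrite zmul0l]; zmodule.
  - zmodule.
  - zmodule.
  - rewrite IHt, IHu. zmodule.
  - rewrite IHt. zmodule.
Qed.

Definition tzmul (z : Z) (t : term) : term :=
  TAdd (tnmul (Z.to_nat z) t) (TNeg (tnmul (Z.to_nat (- z)) t)).

Lemma teval_tzmul v z t : teval U v (tzmul z t) = z ⊙ teval U v t.
Proof. unfold tzmul; simpl. rewrite !teval_tnmul. reflexivity. Qed.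

Local Opaque tzmul.

(** * Colours *)

Variable P : U -> Prop.
Hypothesis P_sym : symmetric_set U P.

Definition inmul (N : Z) (x : U) : Prop := exists y, P y /\ x = N ⊙ y.

Definition decb (Q : Prop) : bool := if excluded_middle_informative Q then true else false.

Lemma decbP (Q : Prop) : decb Q = true <-> Q.
Proof. unfold decb; destruct (excluded_middle_informative Q); intuition discriminate. Qed.

Lemma decb_inj (Q Q' : Prop) : decb Q = decb Q' <-> (Q <-> Q').
Proof.
  unfold decb; destruct (excluded_middle_informative Q), (excluded_middle_informative Q');
    intuition discriminate.
Qed.

Record color := Color { is_zero : bool; is_dvd : bool; is_mem : bool }.

Definition all_colors : list color :=
  [ Color true true true; Color true true false; Color true false true;
    Color true false false; Color false true true; Color false true false;
    Color false false true; Color false false false ].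

Lemma in_all_colors c : In c all_colors.
Proof. destruct c as [[] [] []]; simpl; intuition. Qed.

Definition col (N : Z) (x : U) : color :=
  Color (decb (x = 'O)) (decb (zdvd N x)) (decb (inmul N x)).

Lemma col_eq N N' x x' : col N x = col N' x' <->
  (x = 'O <-> x' = 'O) /\ (zdvd N x <-> zdvd N' x') /\ (inmul N x <-> inmul N' x').
Proof.
  unfold col.
  rewrite <- (decb_inj (x = 'O)), <- (decb_inj (zdvd N x)), <- (decb_inj (inmul N x)).
  split.
  - intros H; injection H; auto.
  - intros [-> [-> ->]]; reflexivity.
Qed.

(** Torsion-freeness makes multiplication by [m] reversible. This brings conditions with different
    moduli to a common one and permits substituting a solution of [m ⊙ a = t]. *)
Lemma col_scale m N x : m <> 0%Z -> col (m * N) (m ⊙ x) = col N x.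
Proof.
  intros Hm. apply col_eq. split; [|split].
  - split; [apply zmul_eq0, Hm|intros ->; apply zmul0r].
  - apply zdvd_scale, Hm.
  - split; intros [y [Hy E]]; exists y; (split; [exact Hy|]).
    + apply (zmul_inj m _ _ Hm). rewrite E. zmodule.
    + rewrite E. zmodule.
Qed.

(** Symmetry of [P] enters here. It makes the sign of a term irrelevant, so that coefficients of the
    variable to be eliminated may be taken nonnegative, as additive randomness requires. *)
Lemma col_opp N x : col N (⊖ x) = col N x.
Proof.
  assert (K : forall y, (⊖ y = 'O -> y = 'O) /\ (zdvd N (⊖ y) -> zdvd N y) /\
                        (inmul N (⊖ y) -> inmul N y)).
  { intros y. split; [|split].
    - intros H. rewrite <- (zg_oppK y), H. apply zg_opp0.
    - intros [z Hz]. exists (⊖ z). rewrite <- (zg_oppK y), Hz. zmodule.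
    - intros [z [Pz Hz]]. exists (⊖ z). split; [apply P_sym in Pz; exact Pz|].
      rewrite <- (zg_oppK y), Hz. zmodule. }
  pose proof (K x) as K1. pose proof (K (⊖ x)) as K2. rewrite zg_oppK in K2.
  apply col_eq. tauto.
Qed.

Lemma inmul_zdvd N x : inmul N x -> zdvd N x.
Proof. intros [y [_ H]]; exists y; exact H. Qed.

(* (P1)-(P3) without [chi]: by (P2) and (P3), [chi] may be replaced by the absence of a
   congruence obstruction modulo some [k] in [dd]; [zs] collects the integers of (P3). *)
Definition random_witness (ms ms' dd zs : list Z) : Prop :=
  (forall k, In k dd -> (1 <= k)%Z) /\
  (forall L L' : list (Z * U), map fst L = ms -> map fst L' = ms' ->
     (forall p, In p L -> ~ In p L') ->
     (forall k, In k dd -> exists s, In s (zrange k) /\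
        forall p, In p L -> ~ zdvd k ((fst p * s) ⊙ s1 U ⊕ snd p)) ->
     forall F : list U, exists y, ~ In y F /\
       (forall p, In p L -> P (fst p ⊙ y ⊕ snd p)) /\
       (forall p, In p L' -> ~ P (fst p ⊙ y ⊕ snd p))) /\
  (forall k, In k dd -> forall x, P x -> zdvd k x -> exists z, In z zs /\ x = z ⊙ s1 U).

(** * Realizing prescribed colours by a single element *)

Section Realize.

Variables (X : Type) (J : list X) (m : X -> Z) (c : X -> color) (N s : Z).
Hypothesis HN : (1 <= N)%Z.
Hypothesis Hm : forall x, In x J -> (0 <= m x)%Z.

(** An index [x] in [J] stands for the demand that [m x ⊙ a ⊕ u x] have colour [c x], where [a] is
    sought in the class of [s] modulo [N]. The two lists hold the coefficients of the terms to be
    put into [N P] and of the multiples of [N] to be kept out of it. They depend neither on [u] nor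
    on [s], so one pair [dd], [zs] serves all parameters. *)
Definition pos_part : list Z :=
  map m (filter (fun x => (0 <? m x)%Z && is_mem (c x))%bool J).
Definition neg_part : list Z :=
  map m (filter (fun x => (0 <? m x)%Z && (is_dvd (c x) && negb (is_mem (c x))))%bool J).

Variables dd zs : list Z.

(** This is the failure, at [k], of the congruence condition in [random_witness] for the constants
    [(m x * s + u x) / N]. Multiplication by [N] has removed the quotients, which leaves
    divisibility conditions on terms. *)
Definition obstructed (u : X -> U) (k : Z) : Prop :=
  forall s', In s' (zrange k) -> exists x, In x J /\
    (0 < m x)%Z /\ is_mem (c x) = true /\
    zdvd (k * N) ((m x * (N * s' + s)) ⊙ s1 U ⊕ u x).

(* Substituting [N y + s] for the variable turns membership of [m a + u] in [N P] into
   membership of [m y + (m s + u) / N] in [P]. *)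
Lemma realize_colors (u : X -> U) :
  random_witness pos_part neg_part dd zs ->
  (forall x, In x J -> m x = 0%Z -> col N (u x) = c x) ->
  (forall x, In x J -> (0 < m x)%Z -> is_zero (c x) = false /\
     is_dvd (c x) = decb (zdvd N ((m x * s) ⊙ s1 U ⊕ u x)) /\
     (is_mem (c x) = true -> is_dvd (c x) = true)) ->
  (forall x x', In x J -> In x' J -> (0 < m x)%Z -> m x = m x' -> u x = u x' -> c x = c x') ->
  (forall k, In k dd -> ~ obstructed u k) ->
  exists a, forall x, In x J -> col N (m x ⊙ a ⊕ u x) = c x.
Proof.
  intros [_ [HAR _]] H0 Hp Hd Hob.
  set (q := fun x => zquot N ((m x * s) ⊙ s1 U ⊕ u x)).
  assert (Hq : forall x, In x J -> (0 < m x)%Z -> is_dvd (c x) = true ->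
            (m x * s) ⊙ s1 U ⊕ u x = N ⊙ q x).
  { intros x Hx Hx1 Hx2. apply zquot_spec, decbP.
    destruct (Hp x Hx Hx1) as [_ [<- _]]. exact Hx2. }
  set (L := map (fun x => (m x, q x)) (filter (fun x => (0 <? m x)%Z && is_mem (c x))%bool J)).
  set (L' := map (fun x => (m x, q x))
     (filter (fun x => (0 <? m x)%Z && (is_dvd (c x) && negb (is_mem (c x))))%bool J)).
  assert (HL : forall p, In p L <-> exists x, In x J /\ (0 < m x)%Z /\ is_mem (c x) = true /\
     p = (m x, q x)).
  { intros p. unfold L. rewrite in_map_iff. split.
    - intros [x [E Hx]]. apply filter_In in Hx. rewrite andb_true_iff, Z.ltb_lt in Hx.
      exists x. intuition.
    - intros [x [H1 [H2 [H3 ->]]]]. exists x. split; [reflexivity|].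
      apply filter_In. rewrite andb_true_iff, Z.ltb_lt. auto. }
  assert (HL' : forall p, In p L' <-> exists x, In x J /\ (0 < m x)%Z /\
     is_dvd (c x) = true /\ is_mem (c x) = false /\ p = (m x, q x)).
  { intros p. unfold L'. rewrite in_map_iff. split.
    - intros [x [E Hx]]. apply filter_In in Hx.
      rewrite !andb_true_iff, negb_true_iff, Z.ltb_lt in Hx. exists x. intuition.
    - intros [x [H1 [H2 [H3 [H4 ->]]]]]. exists x. split; [reflexivity|].
      apply filter_In. rewrite !andb_true_iff, negb_true_iff, Z.ltb_lt. auto. }
  (* The finite set to avoid contains every [y] for which some [m x ⊙ (N y + s) ⊕ u x] with positive
     [m x] is 0: solve for [y] by two divisions. Junk values of [zquot] only exclude further
     elements. *)
  destruct (HAR L L') with (F := map (fun x => zquot N (zquot (m x) (⊖ u x) ⊕ ⊖ (s ⊙ s1 U))) J)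
    as [y [HyF [Hy Hy']]].
  - unfold L, pos_part. rewrite map_map. reflexivity.
  - unfold L', neg_part. rewrite map_map. reflexivity.
  (* A pair in both lists comes from two indices with equal coefficients and equal constants. Their
     colours would agree, while one demands membership and the other forbids it. *)
  - intros p Hp1 Hp2. apply HL in Hp1. apply HL' in Hp2.
    destruct Hp1 as [x [A1 [A2 [A3 E1]]]]. destruct Hp2 as [x' [B1 [B2 [B3 [B4 E2]]]]].
    subst p. injection E2 as E3 E4.
    assert (is_mem (c x) = is_mem (c x')) as K; [|congruence].
    f_equal. apply Hd; try assumption.
    apply (zg_cancel ((m x * s) ⊙ s1 U)). rewrite (Hq x A1 A2), E3, (Hq x' B1 B2 B3), E4;
      [reflexivity|].
    apply (Hp x A1 A2), A3.
  (* If every residue [s'] is blocked modulo [k] by a pair in [L], scaling by [N] gives exactly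
     [obstructed u k]. *)
  - intros k Hk. apply NNPP. intros Hn. apply (Hob k Hk). intros s' Hs'.
    apply NNPP. intros Hn2. apply Hn. exists s'. split; [exact Hs'|].
    intros p Hp1 Hdv. apply HL in Hp1. destruct Hp1 as [x [A1 [A2 [A3 ->]]]].
    apply Hn2. exists x. repeat split; try assumption. simpl in Hdv.
    rewrite <- (zdvd_scale N) in Hdv by lia. rewrite Z.mul_comm.
    replace ((m x * (N * s' + s)) ⊙ s1 U ⊕ u x) with (N ⊙ ((m x * s') ⊙ s1 U ⊕ q x));
      [exact Hdv|].
    rewrite zmulDr, <- (Hq x A1 A2); [zmodule|]. apply (Hp x A1 A2), A3.
  - exists (N ⊙ y ⊕ s ⊙ s1 U). intros x Hx.
    destruct (Z.eq_dec (m x) 0) as [Hx0|Hx0].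
    { rewrite <- (H0 x Hx Hx0). f_equal. rewrite Hx0, zmul0l. zmodule. }
    assert (Hx1 : (0 < m x)%Z) by (specialize (Hm x Hx); lia).
    destruct (Hp x Hx Hx1) as [Hz [Hdv Hmd]].
    replace (m x ⊙ (N ⊙ y ⊕ s ⊙ s1 U) ⊕ u x)
      with (((m x * s) ⊙ s1 U ⊕ u x) ⊕ N ⊙ (m x ⊙ y)) by zmodule.
    assert (E1 : decb (((m x * s) ⊙ s1 U ⊕ u x) ⊕ N ⊙ (m x ⊙ y) = 'O) = is_zero (c x)).
    { rewrite Hz. apply not_true_is_false. rewrite decbP. intros E. apply HyF.
      apply in_map_iff. exists x. split; [|exact Hx].
      assert (E2 : ⊖ u x = m x ⊙ (N ⊙ y ⊕ s ⊙ s1 U)).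
      { apply zg_sub_eq0. rewrite <- (zg_opp0), <- E. zmodule. }
      rewrite E2, zquot_mul by lia.
      replace (N ⊙ y ⊕ s ⊙ s1 U ⊕ ⊖ (s ⊙ s1 U)) with (N ⊙ y) by zmodule.
      apply zquot_mul; lia. }
    assert (E2 : decb (zdvd N (((m x * s) ⊙ s1 U ⊕ u x) ⊕ N ⊙ (m x ⊙ y))) = is_dvd (c x)).
    { rewrite Hdv. apply decb_inj. apply zdvd_add. eexists; reflexivity. }
    assert (E3 : decb (inmul N (((m x * s) ⊙ s1 U ⊕ u x) ⊕ N ⊙ (m x ⊙ y))) = is_mem (c x)).
    { destruct (is_mem (c x)) eqn:Em.
      - apply decbP. exists (m x ⊙ y ⊕ q x). split.
        + apply (Hy (m x, q x)). apply HL. exists x; auto.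
        + rewrite (Hq x Hx Hx1 (Hmd eq_refl)). zmodule.
      - apply not_true_is_false. rewrite decbP. intros Hin.
        assert (Hdx : is_dvd (c x) = true) by (rewrite <- E2; apply decbP, inmul_zdvd, Hin).
        destruct Hin as [d [Pd Ed]].
        apply (Hy' (m x, q x)); [apply HL'; exists x; auto|]. simpl.
        replace (m x ⊙ y ⊕ q x) with d; [exact Pd|].
        apply (zmul_inj N); [lia|]. rewrite <- Ed, (Hq x Hx Hx1 Hdx). zmodule. }
    unfold col. rewrite E1, E2, E3. destruct (c x); reflexivity.
Qed.

(** Take the residue [s'] of [y] modulo [k]. The obstruction at [s'] names a term whose value at [a]
    is divisible by [k * N] and, by its colour, equals [N d] with [d] in [P]. Then [k] divides [d],
    so [d] is one of the finitely many integers in [zs]. *)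
Lemma obstructed_solution (u : X -> U) (k : Z) (a y : U) :
  (forall d, P d -> zdvd k d -> exists z, In z zs /\ d = z ⊙ s1 U) ->
  (1 <= k)%Z -> obstructed u k -> a = N ⊙ y ⊕ s ⊙ s1 U ->
  (forall x, In x J -> col N (m x ⊙ a ⊕ u x) = c x) ->
  exists x z, In x J /\ (0 < m x)%Z /\ In z zs /\ m x ⊙ a ⊕ u x = (N * z) ⊙ s1 U.
Proof.
  intros Hzs Hk Hob Ea Ha.
  destruct (zdvd_residue k y Hk) as [s' [y' [Hs' Ey]]].
  destruct (Hob s' Hs') as [x [Hx [Hx1 [Hx2 [w Hw]]]]].
  rewrite <- (Ha x Hx) in Hx2.
  apply (proj1 (decbP (inmul N _))) in Hx2. destruct Hx2 as [d [Pd Ed]].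
  assert (Hkd : zdvd k d).
  { exists (m x ⊙ y' ⊕ w). apply (zmul_inj N); [lia|]. rewrite <- Ed.
    transitivity ((k * N * m x) ⊙ y' ⊕ (k * N) ⊙ w); [|zmodule].
    rewrite <- Hw, Ea, Ey. zmodule. }
  destruct (Hzs d Pd Hkd) as [z [Hz Edz]].
  exists x, z. repeat split; try assumption. rewrite Ed, Edz. zmodule.
Qed.

End Realize.
(** * Quantifier elimination *)

Hypothesis P_random : forall ms ms' : list Z,
  (forall m, In m ms -> (1 <= m)%Z) -> (forall m, In m ms' -> (1 <= m)%Z) ->
  exists dd zs, random_witness ms ms' dd zs.

Lemma part_random (X : Type) (J : list X) (m : X -> Z) (c : X -> color) :
  exists dd zs, random_witness (pos_part X J m c) (neg_part X J m c) dd zs.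
Proof.
  apply P_random; intros k Hk; apply in_map_iff in Hk; destruct Hk as [x [<- Hx]];
    apply filter_In in Hx; rewrite andb_true_iff, Z.ltb_lt in Hx; lia.
Qed.

Definition determined (N : Z) (ts : list term) (A : (nat -> U) -> Prop) : Prop :=
  forall v w, (forall t, In t ts -> col N (teval U v t) = col N (teval U w t)) -> A v -> A w.

(* Semantic stand-in for "quantifier-free": a Boolean combination of the conditions
   [t = 0], [N | t] and [t \in N P] on finitely many terms [t]. *)
Definition QF (A : (nat -> U) -> Prop) : Prop :=
  exists N ts, (1 <= N)%Z /\ determined N ts A.

Lemma QF_iff A A' : (forall v, A v <-> A' v) -> QF A -> QF A'.
Proof.
  intros H [N [ts [HN D]]]. exists N, ts. split; [exact HN|].
  intros v w Hvw Hv. apply H, (D v w Hvw), H, Hv.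
Qed.

Lemma QF_not A : QF A -> QF (fun v => ~ A v).
Proof.
  intros [N [ts [HN D]]]. exists N, ts. split; [exact HN|].
  intros v w Hvw Hv Hw. apply Hv, (D w v); [|exact Hw].
  intros; symmetry; apply Hvw; assumption.
Qed.

Lemma determined_scale m N ts A : m <> 0%Z -> determined N ts A ->
  determined (m * N) (map (tzmul m) ts) A.
Proof.
  intros Hm D v w Hvw. apply D. intros t Ht.
  rewrite <- (col_scale m N _ Hm), <- (col_scale m N (teval U w t) Hm), <- !teval_tzmul.
  apply Hvw, in_map, Ht.
Qed.

Lemma determined_incl N ts ts' A : incl ts ts' -> determined N ts A -> determined N ts' A.
Proof. intros H D v w Hvw. apply D. intros; apply Hvw, H; assumption. Qed.

Lemma QF_and A A' : QF A -> QF A' -> QF (fun v => A v /\ A' v).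
Proof.
  intros [N [ts [HN D]]] [N' [ts' [HN' D']]].
  apply (determined_scale N') in D; [|lia]. apply (determined_scale N) in D'; [|lia].
  rewrite Z.mul_comm in D. exists (N * N')%Z, (map (tzmul N') ts ++ map (tzmul N) ts').
  split; [nia|]. intros v w Hvw [Hv Hv']. split.
  - revert Hv. apply (determined_incl _ _ _ _ (incl_appl _ (incl_refl _)) D v w Hvw).
  - revert Hv'. apply (determined_incl _ _ _ _ (incl_appr _ (incl_refl _)) D' v w Hvw).
Qed.

Lemma QF_const (Q : Prop) : QF (fun _ => Q).
Proof. exists 1%Z, []. split; [lia|]. intros v w _ H; exact H. Qed.

(** As [Q] is external, it may be assumed while [A] is treated; if it fails, the condition is
    constant. *)
Lemma QF_imp (Q : Prop) A : (Q -> QF A) -> QF (fun v => Q -> A v).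
Proof.
  intros H. destruct (classic Q) as [HQ|HQ].
  - apply QF_iff with A; [tauto|auto].
  - apply QF_iff with (fun _ => True); [tauto|apply QF_const].
Qed.

Lemma QF_all_in {T} (l : list T) (A : T -> (nat -> U) -> Prop) :
  (forall x, In x l -> QF (A x)) -> QF (fun v => forall x, In x l -> A x v).
Proof.
  induction l as [|x l IH]; intros H.
  - apply QF_iff with (fun _ => True); [simpl; tauto|apply QF_const].
  - apply QF_iff with (fun v => A x v /\ forall y, In y l -> A y v).
    + intros; simpl; split; [|intuition]. intros [K1 K2] y [<-|Hy]; auto.
    + apply QF_and; [apply H; simpl; auto|]. apply IH. intros; apply H; simpl; auto.
Qed.

Lemma QF_ex_in {T} (l : list T) (A : T -> (nat -> U) -> Prop) :
  (forall x, In x l -> QF (A x)) -> QF (fun v => exists x, In x l /\ A x v).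
Proof.
  intros H. apply QF_iff with (fun v => ~ forall x, In x l -> ~ A x v).
  - intros; split.
    + intros K; apply NNPP; intros K2; apply K; intros x Hx K3; apply K2; eauto.
    + intros [x [Hx K]] K2; eapply K2; eauto.
  - apply QF_not, QF_all_in. intros; apply QF_not; auto.
Qed.

Lemma QF_or A A' : QF A -> QF A' -> QF (fun v => A v \/ A' v).
Proof.
  intros H H'. apply QF_iff with (fun v => ~ (~ A v /\ ~ A' v)).
  - intros v; split; [intros K; apply NNPP; tauto|tauto].
  - apply QF_not, QF_and; apply QF_not; assumption.
Qed.

Lemma QF_col N t (K : color -> Prop) : (1 <= N)%Z -> QF (fun v => K (col N (teval U v t))).
Proof.
  intros HN. exists N, [t]. split; [exact HN|].
  intros v w Hvw. rewrite (Hvw t) by (simpl; auto). auto.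
Qed.

Lemma QF_zdvd N t : (1 <= N)%Z -> QF (fun v => zdvd N (teval U v t)).
Proof.
  intros HN. apply QF_iff with (fun v => is_dvd (col N (teval U v t)) = true).
  - intros v. apply decbP.
  - apply (QF_col N t (fun c => is_dvd c = true) HN).
Qed.

Lemma QF_eq t t' : QF (fun v => teval U v t = teval U v t').
Proof.
  apply QF_iff with (fun v => is_zero (col 1 (teval U v (TAdd t (TNeg t')))) = true).
  - intros v. unfold col, is_zero. rewrite decbP. simpl.
    split; [apply zg_sub_eq0|]. intros ->. zmodule.
  - apply (QF_col 1 _ (fun c => is_zero c = true)). lia.
Qed.

Lemma QF_mem t : QF (fun v => P (teval U v t)).
Proof.
  apply QF_iff with (fun v => is_mem (col 1 (teval U v t)) = true).
  - intros v. unfold col, is_mem. rewrite decbP. split.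
    + intros [y [Py ->]]. rewrite zmul1l. exact Py.
    + intros Py. exists (teval U v t). rewrite zmul1l. auto.
  - apply (QF_col 1 _ (fun c => is_mem c = true)). lia.
Qed.

(* If [m a = t], then [m t'(a)] is a term not involving [a]. *)
Lemma QF_solve A m t i : (1 <= m)%Z -> QF A ->
  QF (fun v => exists a, m ⊙ a = teval U v t /\ A (upd U v i a)).
Proof.
  intros Hm [N [ts [HN D]]].
  (* The colour of [N t] modulo [m * N] records whether [m] divides [t], that is, whether the
     equation is solvable. The other terms are the values [m t'(a)] rewritten without [a]. *)
  exists (m * N)%Z, (tzmul N t ::
    map (fun t' => TAdd (tzmul (coef i t') t) (tzmul m (tdrop i t'))) ts).
  split; [nia|]. intros v w Hvw [a [Ea Ha]].
  assert (Hw : zdvd m (teval U w t)).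
  { assert (K : zdvd (m * N) (teval U w (tzmul N t))).
    { specialize (Hvw _ (or_introl eq_refl)). apply col_eq in Hvw. apply Hvw.
      exists a. rewrite teval_tzmul, <- Ea. zmodule. }
    rewrite teval_tzmul, Z.mul_comm in K. apply zdvd_scale in K; [exact K|lia]. }
  destruct Hw as [b Eb]. exists b. split; [symmetry; exact Eb|].
  apply (D (upd U v i a)); [|exact Ha]. intros t' Ht'.
  rewrite !teval_upd, <- (col_scale m N), <- (col_scale m N (_ ⊙ b ⊕ _)) by lia.
  specialize (Hvw (TAdd (tzmul (coef i t') t) (tzmul m (tdrop i t')))).
  simpl in Hvw. rewrite !teval_tzmul, Eb, <- Ea in Hvw.
  replace (m ⊙ (coef i t' ⊙ a ⊕ teval U v (tdrop i t')))
    with (coef i t' ⊙ (m ⊙ a) ⊕ m ⊙ teval U v (tdrop i t')) by zmodule.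
  replace (m ⊙ (coef i t' ⊙ b ⊕ teval U w (tdrop i t')))
    with (coef i t' ⊙ (m ⊙ b) ⊕ m ⊙ teval U w (tdrop i t')) by zmodule.
  apply Hvw. right. apply in_map_iff. exists t'; auto.
Qed.

(** The sign of the term is chosen to make the coefficient of variable [i] nonnegative; by [col_opp]
    its colour is unaffected. *)
Definition tabs (i : nat) (t : term) : term := if (coef i t <? 0)%Z then TNeg t else t.

Lemma coef_tabs i t : (0 <= coef i (tabs i t))%Z.
Proof. unfold tabs. destruct (Z.ltb_spec (coef i t) 0); simpl; lia. Qed.

Lemma determined_tabs i N ts A : determined N ts A -> determined N (map (tabs i) ts) A.
Proof.
  intros D v w Hvw. apply D. intros t Ht.
  specialize (Hvw (tabs i t) (in_map _ _ _ Ht)). unfold tabs in Hvw.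
  destruct (coef i t <? 0)%Z; [|exact Hvw]. simpl in Hvw. rewrite !col_opp in Hvw. exact Hvw.
Qed.

(** There are finitely many colours, so quantifying over all colourings of [ts] is a finite
    disjunction. *)
Fixpoint colorings (ts : list term) : list (list (term * color)) :=
  match ts with
  | [] => [[]]
  | t :: ts' => flat_map (fun J => map (fun c => (t, c) :: J) all_colors) (colorings ts')
  end.

Lemma in_colorings (ts : list term) (f : term -> color) :
  In (map (fun t => (t, f t)) ts) (colorings ts).
Proof.
  induction ts as [|t ts IH]; [simpl; auto|].
  apply in_flat_map. exists (map (fun t => (t, f t)) ts). split; [exact IH|].
  apply (in_map (fun c => (t, c) :: map (fun t => (t, f t)) ts)), in_all_colors.
Qed.

Definition colored (N : Z) (J : list (term * color)) (v : nat -> U) : Prop :=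
  forall x, In x J -> col N (teval U v (fst x)) = snd x.

Lemma determined_colored N ts A J v w : determined N ts A ->
  (forall t, In t ts -> exists c, In (t, c) J) ->
  colored N J v -> colored N J w -> A v -> A w.
Proof.
  intros D HJ Hv Hw. apply D. intros t Ht. destruct (HJ t Ht) as [c Hc].
  exact (eq_trans (Hv _ Hc) (eq_sym (Hw _ Hc))).
Qed.

Lemma colored_exists N ts v : exists J, In J (colorings ts) /\
  (forall t, In t ts -> exists c, In (t, c) J) /\ (forall x, In x J -> In (fst x) ts) /\
  colored N J v.
Proof.
  exists (map (fun t => (t, col N (teval U v t))) ts). split; [|split; [|split]].
  - apply in_colorings.
  - intros t Ht. eexists. apply in_map_iff. exists t. split; [reflexivity|exact Ht].
  - intros x Hx. apply in_map_iff in Hx. destruct Hx as [t [<- Ht]]. exact Ht.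
  - intros x Hx. apply in_map_iff in Hx. destruct Hx as [t [<- Ht]]. reflexivity.
Qed.

Lemma is_mem_is_dvd N x : is_mem (col N x) = true -> is_dvd (col N x) = true.
Proof. unfold col, is_mem, is_dvd. rewrite !decbP. apply inmul_zdvd. Qed.

Lemma zdvd_shift N m s y u :
  zdvd N (m ⊙ (N ⊙ y ⊕ s ⊙ s1 U) ⊕ u) <-> zdvd N ((m * s) ⊙ s1 U ⊕ u).
Proof.
  replace (m ⊙ (N ⊙ y ⊕ s ⊙ s1 U) ⊕ u) with ((m * s) ⊙ s1 U ⊕ u ⊕ N ⊙ (m ⊙ y)) by zmodule.
  apply zdvd_add. eexists; reflexivity.
Qed.

(** Either [a] solves one of finitely many linear equations, which [QF_solve] handles, or the
    sufficient conditions of [realize_colors] are also necessary. Both alternatives are conditions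
    on the remaining variables. *)
Lemma QF_ex_colored N J i : (1 <= N)%Z -> (forall x, In x J -> (0 <= coef i (fst x))%Z) ->
  QF (fun v => exists a, colored N J (upd U v i a)).
Proof.
  intros HN HJ.
  set (m := fun x : term * color => coef i (fst x)).
  set (u := fun v (x : term * color) => teval U v (tdrop i (fst x))).
  destruct (part_random _ J m snd) as [dd [zs [Hdd [HW Hzs]]]].
  (* The equation says that the term of [p] takes the value [N z] at [a]. In [J1], [z = 0] accounts
     for terms that vanish and [z] in [zs] for terms forced by an obstruction. *)
  set (E := fun (p : (term * color) * Z) v => exists a,
     m (fst p) ⊙ a = teval U v (TAdd (tzmul (N * snd p) TOne) (TNeg (tdrop i (fst (fst p))))) /\
     colored N J (upd U v i a)).
  set (J1 := list_prod (filter (fun x => (0 <? m x)%Z) J) (0%Z :: zs)).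
  (* These are the hypotheses of [realize_colors] for the residue [s]. *)
  set (B := fun s v =>
    (forall x, In x J -> m x = 0%Z -> col N (u v x) = snd x) /\
    (forall x, In x J -> (0 < m x)%Z -> is_zero (snd x) = false /\
       is_dvd (snd x) = decb (zdvd N ((m x * s) ⊙ s1 U ⊕ u v x)) /\
       (is_mem (snd x) = true -> is_dvd (snd x) = true)) /\
    (forall x, In x J -> forall x', In x' J -> (0 < m x)%Z -> m x = m x' ->
       u v x = u v x' -> snd x = snd x') /\
    (forall k, In k dd -> ~ obstructed _ J m snd N s (u v) k)).
  apply QF_iff with (fun v => (exists p, In p J1 /\ E p v) \/ exists s, In s (zrange N) /\ B s v).
  - intros v; split.
    + intros [[p [_ [a [_ Ha]]]]|[s [_ [B1 [B2 [B3 B4]]]]]]; [exists a; exact Ha|].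
      destruct (realize_colors _ J m snd N s HN HJ dd zs (u v) (conj Hdd (conj HW Hzs)))
        as [a Ha]; try assumption.
      { intros x x' Hx Hx'. apply B3; assumption. }
      exists a. intros x Hx. rewrite teval_upd. apply Ha, Hx.
    + intros [a Ha].
      destruct (classic (exists p, In p J1 /\ m (fst p) ⊙ a =
        teval U v (TAdd (tzmul (N * snd p) TOne) (TNeg (tdrop i (fst (fst p))))))) as [Hp|Hp].
      { left. destruct Hp as [p [Hp Ep]]. exists p. split; [exact Hp|].
        exists a; auto. }
      (* From here on [a] solves none of the equations indexed by [J1]. Hence no term with positive
         coefficient vanishes at [a], and an obstruction is impossible by [obstructed_solution]. *)
      right. destruct (zdvd_residue N a HN) as [s [y [Hs Ey]]].
      exists s. split; [exact Hs|].
      assert (Hc : forall x, In x J -> col N (m x ⊙ a ⊕ u v x) = snd x).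
      { intros x Hx. rewrite <- (Ha x Hx), teval_upd. reflexivity. }
      assert (Hne : forall x z, In x J -> (0 < m x)%Z -> In z (0%Z :: zs) ->
        m x ⊙ a ⊕ u v x <> (N * z) ⊙ s1 U).
      { intros x z Hx Hx1 Hz Ez. apply Hp. exists (x, z). split.
        - apply in_prod; [|exact Hz]. apply filter_In. rewrite Z.ltb_lt. auto.
        - simpl. rewrite !teval_tzmul. simpl. fold (u v x). rewrite <- Ez. zmodule. }
      split; [|split; [|split]].
      * intros x Hx Hx0. rewrite <- (Hc x Hx). f_equal. rewrite Hx0, zmul0l. zmodule.
      * intros x Hx Hx1. rewrite <- (Hc x Hx) at 1 2 3 4. split; [|split].
        -- apply not_true_is_false. unfold col, is_zero. rewrite decbP.
           rewrite <- (zmul0l (s1 U)). replace 0%Z with (N * 0)%Z by lia.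
           apply Hne; simpl; auto.
        -- unfold col, is_dvd. apply decb_inj. rewrite Ey. apply zdvd_shift.
        -- apply is_mem_is_dvd.
      * intros x Hx x' Hx' Hx1 Em Eu. rewrite <- (Hc x Hx), <- (Hc x' Hx'), Em, Eu.
        reflexivity.
      * intros k Hk Hob.
        destruct (obstructed_solution _ J m snd N s HN zs (u v) k a y (Hzs k Hk) (Hdd k Hk)
          Hob Ey Hc) as [x [z [Hx [Hx1 [Hz Ez]]]]].
        apply (Hne x z Hx Hx1); simpl; auto.
  - apply QF_or.
    + apply QF_ex_in. intros [x z] Hp. apply in_prod_iff in Hp. destruct Hp as [Hx _].
      apply filter_In in Hx. rewrite Z.ltb_lt in Hx.
      apply QF_solve; [simpl; lia|]. apply QF_all_in. intros y Hy.
      apply (QF_col N (fst y) (fun c => c = snd y) HN).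
    + apply QF_ex_in. intros s _. unfold B. apply QF_and; [|apply QF_and; [|apply QF_and]].
      * apply QF_all_in. intros x Hx. apply QF_imp. intros _.
        apply (QF_col N _ (fun c => c = snd x) HN).
      * apply QF_all_in. intros x Hx. apply QF_imp. intros _.
        apply QF_and; [apply QF_const|]. apply QF_and; [|apply QF_const].
        apply QF_iff with (fun v => is_dvd (snd x) = is_dvd (col N
           (teval U v (TAdd (tzmul (m x * s) TOne) (tdrop i (fst x)))))).
        -- intros v. simpl. rewrite teval_tzmul. reflexivity.
        -- apply (QF_col N _ (fun c => is_dvd (snd x) = is_dvd c) HN).
      * apply QF_all_in. intros x Hx. apply QF_all_in. intros x' Hx'.
        apply QF_imp. intros _. apply QF_imp. intros _.
        apply QF_iff with (fun v => ~ (u v x = u v x' /\ ~ snd x = snd x')).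
        -- intros v; split; [intros K Eu; apply NNPP; tauto|tauto].
        -- apply QF_not, QF_and; [apply QF_eq|apply QF_const].
      * apply QF_all_in. intros k Hk. apply QF_not. apply QF_all_in. intros s' _.
        apply QF_ex_in. intros x _. apply QF_and; [apply QF_const|].
        apply QF_and; [apply QF_const|].
        apply QF_iff with (fun v => zdvd (k * N)
          (teval U v (TAdd (tzmul (m x * (N * s' + s)) TOne) (tdrop i (fst x))))).
        -- intros v. simpl. rewrite teval_tzmul. reflexivity.
        -- apply QF_zdvd. specialize (Hdd k Hk). nia.
Qed.

(** The truth of [A] depends only on the colouring of finitely many terms. So the quantifier splits
    into a finite disjunction over the colourings [J] that occur at some valuation satisfying [A];
    that last property is external, and what remains is realizing [J]. *)
Lemma QF_ex A i : QF A -> QF (fun v => exists a, A (upd U v i a)).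
Proof.
  intros [N [ts [HN D]]]. apply (determined_tabs i) in D.
  set (ts' := map (tabs i) ts) in D.
  apply QF_iff with (fun v => exists J, In J (colorings ts') /\
    ((forall t, In t ts' -> exists c, In (t, c) J) /\ (forall x, In x J -> In (fst x) ts') /\
     exists w, colored N J w /\ A w) /\ exists a, colored N J (upd U v i a)).
  - intros v; split.
    + intros [J [_ [[H1 [_ [w [Hw Aw]]]] [a Ha]]]]. exists a.
      apply (determined_colored N ts' A J w); assumption.
    + intros [a Ha]. destruct (colored_exists N ts' (upd U v i a)) as [J [H1 [H2 [H3 H4]]]].
      exists J. split; [exact H1|]. split; [|exists a; exact H4]. eauto.
  - apply QF_ex_in. intros J _.
    (* The conjunction is rewritten as a negated implication so that [QF_imp] supplies its external
       part as a hypothesis; the nonnegativity of the coefficients comes from there. *)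
    apply QF_iff with (fun v => ~ (((forall t, In t ts' -> exists c, In (t, c) J) /\
      (forall x, In x J -> In (fst x) ts') /\ exists w, colored N J w /\ A w) ->
      ~ exists a, colored N J (upd U v i a))).
    { intros v; split; [intros K; apply NNPP; tauto|tauto]. }
    apply QF_not, QF_imp. intros [_ [H _]]. apply QF_not, QF_ex_colored; [exact HN|].
    intros x Hx. apply H, in_map_iff in Hx. destruct Hx as [t [<- _]]. apply coef_tabs.
Qed.

Lemma QF_sat f : QF (fun v => sat U P v f).
Proof.
  induction f as [t t'|k j t|t|f IH|f IH f' IH'|n f IH]; simpl.
  - apply QF_eq.
  - destruct (Nat.lt_ge_cases j k) as [H|H].
    + apply QF_iff with (fun v => zdvd (Z.of_nat k)
        (teval U v (TAdd t (TNeg (tnmul j TOne))))); [|apply QF_zdvd; lia].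
      intros v. rewrite <- scong_zdvd by lia. simpl.
      rewrite (zg_cong U HU k j), teval_tnmul. tauto.
    (* For [k <= j] the symbol lies outside the language, and [zg_cong] makes it empty. *)
    + apply QF_iff with (fun _ => False); [|apply QF_const].
      intros v. rewrite (zg_cong U HU k j). split; [tauto|lia].
  - apply QF_mem.
  - apply QF_not, IH.
  - apply QF_and; assumption.
  - exact (QF_ex _ n IH).
Qed.

(** * Dividing *)

Lemma finite_set_union {T V : Type} (l : list T) (A : T -> V -> Prop) :
  (forall x, In x l -> finite_set (A x)) -> finite_set (fun y => exists x, In x l /\ A x y).
Proof.
  induction l as [|x l IH]; intros H.
  - exists []. intros y [x [[] _]].
  - destruct (H x (or_introl eq_refl)) as [l1 H1].
    destruct IH as [l2 H2]; [intros; apply H; simpl; auto|].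
    exists (l1 ++ l2). intros y [z [[<-|Hz] Hy]]; apply in_or_app; [left|right]; eauto.
Qed.

Lemma finite_set_sub {V : Type} (A A' : V -> Prop) :
  (forall y, A y -> A' y) -> finite_set A' -> finite_set A.
Proof. intros H [l Hl]. exists l. auto. Qed.

Lemma finite_set_linear m u d : m <> 0%Z -> finite_set (fun a => m ⊙ a ⊕ u = d).
Proof.
  intros Hm. exists [zquot m (d ⊕ ⊖ u)]. intros a <-. left.
  replace (m ⊙ a ⊕ u ⊕ ⊖ u) with (m ⊙ a) by zmodule. apply zquot_mul, Hm.
Qed.

(* [tren off n t] reads the parameters [x_1 .. x_n] of [t] at [off .. off + n - 1];
   all other variables, in particular [x_0], become [0]. *)
Fixpoint tren (off n : nat) (t : term) : term :=
  match t with
  | TVar O => TZero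
  | TVar (S j) => if Nat.ltb j n then TVar (off + j) else TZero
  | TZero => TZero
  | TOne => TOne
  | TAdd t u => TAdd (tren off n t) (tren off n u)
  | TNeg t => TNeg (tren off n t)
  end.

Lemma teval_tren v off a t :
  (forall j, (j < length a)%nat -> v (off + j)%nat = nth j a 'O) ->
  teval U v (tren off (length a) t) = teval U (env_x U 'O a) t.
Proof.
  intros H. induction t as [[|j]| | |t IHt t' IHt'|t IHt]; simpl; try congruence.
  destruct (Nat.ltb_spec j (length a)) as [Hj|Hj]; simpl; [auto|].
  symmetry. apply nth_overflow, Hj.
Qed.

Lemma teval_env_x x a t :
  teval U (env_x U x a) t = coef 0 t ⊙ x ⊕ teval U (env_x U 'O a) t.
Proof.
  induction t as [[|j]| | |t IHt t' IHt'|t IHt]; simpl.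
  - rewrite zmul1l. zmodule.
  - rewrite zmul0l. zmodule.
  - zmodule.
  - zmodule.
  - rewrite IHt, IHt'. zmodule.
  - rewrite IHt. zmodule.
Qed.

(** * Terms along an indiscernible sequence *)

Section Indiscernible.

Variables (B : U -> Prop) (as_ : nat -> list U) (n : nat).
Hypothesis Hlen : forall i, length (as_ i) = n.
Hypothesis Hind : indiscernible U P B as_.

(** Each component of a colour is first-order in the parameters, and single tuples of the sequence
    satisfy the same formulas. The parameters occupy the variables below [n], so [n] is free to be
    bound as the quotient by [N]. *)
Lemma indiscernible_col N t i j :
  col N (teval U (env_x U 'O (as_ i)) t) = col N (teval U (env_x U 'O (as_ j)) t).
Proof.
  assert (V : forall i y, teval U (upd U (env_list U (as_ i)) n y) (tren 0 n t) =
                          teval U (env_x U 'O (as_ i)) t).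
  { intros i' y. rewrite <- (Hlen i'). apply teval_tren. intros l Hl. unfold upd, env_list.
    simpl. destruct (Nat.eqb_spec l (length (as_ i'))); [lia|reflexivity]. }
  assert (V0 : forall i, teval U (env_list U (as_ i)) (tren 0 n t) =
                         teval U (env_x U 'O (as_ i)) t).
  { intros i'. rewrite <- (Hlen i'). apply teval_tren. reflexivity. }
  assert (I1 : forall psi, sat U P (env_list U (as_ i)) psi <-> sat U P (env_list U (as_ j)) psi).
  { intros psi. pose proof (Hind psi [] (fun y H => match H with end) [i] [j] eq_refl) as K.
    simpl in K. rewrite !app_nil_r in K. apply K; auto. }
  apply col_eq. split; [|split].
  - pose proof (I1 (FEq (tren 0 n t) TZero)) as K. simpl in K. rewrite !V0 in K. exact K.
  - pose proof (I1 (FEx n (FEq (tren 0 n t) (tzmul N (TVar n))))) as K. simpl in K.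
    assert (K' : forall i, (exists y, teval U (upd U (env_list U (as_ i)) n y) (tren 0 n t) =
        teval U (upd U (env_list U (as_ i)) n y) (tzmul N (TVar n))) <->
        zdvd N (teval U (env_x U 'O (as_ i)) t)).
    { intros i'. split; intros [y Hy]; exists y; revert Hy; rewrite V, teval_tzmul;
        simpl; unfold upd; rewrite Nat.eqb_refl; auto. }
    rewrite !K' in K. exact K.
  - pose proof (I1 (FEx n (FAnd (FP (TVar n)) (FEq (tren 0 n t) (tzmul N (TVar n)))))) as K.
    simpl in K.
    assert (K' : forall i, (exists y, P (upd U (env_list U (as_ i)) n y n) /\
        teval U (upd U (env_list U (as_ i)) n y) (tren 0 n t) =
        teval U (upd U (env_list U (as_ i)) n y) (tzmul N (TVar n))) <->
        inmul N (teval U (env_x U 'O (as_ i)) t)).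
    { intros i'. split; intros [y Hy]; exists y; revert Hy; rewrite V, teval_tzmul;
        simpl; unfold upd; rewrite Nat.eqb_refl; auto. }
    rewrite !K' in K. exact K.
Qed.

Lemma indiscernible_eq t t' i j i' j' : (i < j)%nat -> (i' < j')%nat ->
  teval U (env_x U 'O (as_ i)) t = teval U (env_x U 'O (as_ j)) t' ->
  teval U (env_x U 'O (as_ i')) t = teval U (env_x U 'O (as_ j')) t'.
Proof.
  intros Hij Hij'.
  pose proof (Hind (FEq (tren 0 n t) (tren n n t')) [] (fun y H => match H with end)
    [i; j] [i'; j'] eq_refl) as K.
  simpl in K. rewrite !app_nil_r in K. specialize (K ltac:(auto) ltac:(auto)).
  assert (V : forall i j, teval U (env_list U (as_ i ++ as_ j)) (tren 0 n t) =
                          teval U (env_x U 'O (as_ i)) t).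
  { intros i1 j1. rewrite <- (Hlen i1). apply teval_tren. intros l Hl. unfold env_list.
    rewrite app_nth1 by exact Hl. reflexivity. }
  assert (V' : forall i j, teval U (env_list U (as_ i ++ as_ j)) (tren n n t') =
                          teval U (env_x U 'O (as_ j)) t').
  { intros i1 j1. rewrite <- (Hlen j1) at 2. apply teval_tren. intros l Hl. unfold env_list.
    rewrite app_nth2, Hlen by (rewrite Hlen; lia). f_equal. lia. }
  rewrite !V, !V' in K. apply K.
Qed.

(* [t(a_0) = t'(a_1)] forces [t(a_0) = t(a_1) = t'(a_2) = t'(a_1)]. *)
Lemma indiscernible_eq_diag t t' i j :
  teval U (env_x U 'O (as_ i)) t = teval U (env_x U 'O (as_ j)) t' ->
  teval U (env_x U 'O (as_ 0%nat)) t = teval U (env_x U 'O (as_ 0%nat)) t'.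
Proof.
  assert (D : forall k t t',
    teval U (env_x U 'O (as_ k)) t = teval U (env_x U 'O (as_ k)) t' ->
    teval U (env_x U 'O (as_ 0%nat)) t = teval U (env_x U 'O (as_ 0%nat)) t').
  { intros k t1 t2 H. pose proof (indiscernible_col 1 (TAdd t1 (TNeg t2)) 0 k) as K.
    apply col_eq in K. apply zg_sub_eq0. apply K. simpl. rewrite H. zmodule. }
  assert (D' : forall t t', (exists i j, (i < j)%nat /\
    teval U (env_x U 'O (as_ i)) t = teval U (env_x U 'O (as_ j)) t') ->
    teval U (env_x U 'O (as_ 0%nat)) t = teval U (env_x U 'O (as_ 0%nat)) t').
  { intros t1 t2 [i1 [j1 [Hij H]]].
    assert (K : forall i j, (i < j)%nat ->
      teval U (env_x U 'O (as_ i)) t1 = teval U (env_x U 'O (as_ j)) t2).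
    { intros i2 j2 H2. apply (indiscernible_eq t1 t2 i1 j1); assumption. }
    apply (D 1%nat). rewrite (K 1%nat 2%nat), <- (K 0%nat 2%nat), (K 0%nat 1%nat) by lia.
    reflexivity. }
  intros H. destruct (Nat.lt_trichotomy i j) as [Hij|[Hij|Hij]].
  - apply D'; eauto.
  - subst j. exact (D i t t' H).
  - symmetry. apply D'. exists j, i. auto.
Qed.

End Indiscernible.

(** * Formulas that divide are algebraic *)

Lemma divides_algebraic (B : U -> Prop) (phi : form) (a : list U) :
  divides U P B phi a -> algebraic U P phi a.
Proof.
  intros [as_ [Ha [Hlen [Hind [ns Hns]]]]].
  destruct (QF_sat phi) as [N [ts0 [HN D]]].
  apply (determined_tabs 0) in D.
  assert (Hts : forall t, In t (map (tabs 0) ts0) -> (0 <= coef 0 t)%Z).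
  { intros t Ht. apply in_map_iff in Ht. destruct Ht as [t' [<- _]]. apply coef_tabs. }
  set (ts := map (tabs 0) ts0) in *.
  (* The realizations of [phi] are sorted by colouring and by residue modulo [N]. There are finitely
     many classes, so it suffices to bound each. *)
  set (A := fun J s x => sat U P (env_x U x a) phi /\
    (forall t, In t ts -> exists c, In (t, c) J) /\ (forall p, In p J -> In (fst p) ts) /\
    colored N J (env_x U x a) /\ exists y, x = N ⊙ y ⊕ s ⊙ s1 U).
  apply finite_set_sub with (fun x => exists J, In J (colorings ts) /\
    exists s, In s (zrange N) /\ A J s x).
  { intros x Hx. destruct (colored_exists N ts (env_x U x a)) as [J [H1 [H2 [H3 H4]]]].
    destruct (zdvd_residue N x HN) as [s [y [Hs Hy]]].
    exists J. split; [exact H1|]. exists s. split; [exact Hs|].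
    unfold A. eauto 8. }
  apply finite_set_union. intros J _. apply finite_set_union. intros s _.
  (* If one class is infinite, a common realization of [phi] over all [as_ i] with [i] in [ns] will
     be built, against inconsistency. *)
  apply NNPP. intros Hinf. apply Hns. clear Hns.
  assert (Hex : exists x, A J s x).
  { apply NNPP. intros H. apply Hinf. exists []. intros x Hx. apply H. eauto. }
  destruct Hex as [x0 Hx0]. pose proof Hx0 as [Hphi [HJ1 [HJ2 [Hcol0 [y0 Hy0]]]]].
  set (m := fun x : nat * (term * color) => coef 0 (fst (snd x))).
  set (c := fun x : nat * (term * color) => snd (snd x)).
  (* One demand for each tuple and each coloured term: the same colouring is to be realized over all
     tuples at once. *)
  set (X := list_prod ns J).
  set (u := fun x : nat * (term * color) => teval U (env_x U 'O (as_ (fst x))) (fst (snd x))).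
  assert (HX : forall x, In x X -> In (snd x) J).
  { intros [i p] Hx. apply in_prod_iff in Hx. apply Hx. }
  assert (Hm : forall x, In x X -> (0 <= m x)%Z).
  { intros x Hx. apply Hts, HJ2, HX, Hx. }
  assert (Hc : forall x, A J s x -> forall p, In p J ->
    col N (coef 0 (fst p) ⊙ x ⊕ teval U (env_x U 'O a) (fst p)) = snd p).
  { intros x [_ [_ [_ [K _]]]] p Hp. rewrite <- teval_env_x. apply K, Hp. }
  (* A term with positive coefficient takes each value at one point at most, so it cannot be
     constant on an infinite class. In particular [J] gives it no zero colour. *)
  assert (Hnz : forall p z, In p J -> (0 < coef 0 (fst p))%Z ->
    ~ forall x, A J s x -> coef 0 (fst p) ⊙ x ⊕ teval U (env_x U 'O a) (fst p) = z).
  { intros p z Hp Hp1 K. apply Hinf. eapply finite_set_sub; [exact K|].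
    apply finite_set_linear. lia. }
  assert (Hcol : forall i t k r, col k (r ⊙ s1 U ⊕ teval U (env_x U 'O (as_ i)) t) =
     col k (r ⊙ s1 U ⊕ teval U (env_x U 'O a) t)).
  { intros i t k r. rewrite <- Ha.
    pose proof (indiscernible_col B as_ _ Hlen Hind k (TAdd (tzmul r TOne) t) i 0) as K.
    simpl in K. rewrite !teval_tzmul in K. exact K. }
  destruct (part_random _ X m c) as [dd [zs HW]].
  destruct (realize_colors _ X m c N s HN Hm dd zs u HW) as [x Hx].
  - intros [i p] Hx Hx1. apply HX in Hx. unfold m, u, c in *. simpl in *.
    rewrite <- (Hc x0 Hx0 p Hx), Hx1.
    specialize (Hcol i (fst p) N 0%Z). rewrite !zmul0l in *.
    rewrite !(zg_add0 U HU) in *. exact Hcol.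
  - intros [i p] Hx Hx1. apply HX in Hx. unfold m, u, c in *. simpl in *. split; [|split].
    + apply not_true_is_false. intros K. apply (Hnz p 'O Hx Hx1). intros x HAx.
      rewrite <- (Hc x HAx p Hx) in K. apply (proj1 (decbP (_ = 'O))) in K. exact K.
    + rewrite <- (Hc x0 Hx0 p Hx). unfold col at 1, is_dvd. apply decb_inj.
      specialize (Hcol i (fst p) N (coef 0 (fst p) * s)%Z). apply col_eq in Hcol.
      rewrite (proj1 (proj2 Hcol)), Hy0. apply zdvd_shift.
    + rewrite <- (Hc x0 Hx0 p Hx). apply is_mem_is_dvd.
  (* A coincidence between different tuples already occurs over [a], where [x0] realizes both
     colours; hence the colours agree. *)
  - intros [i p] [j p'] Hx Hx' Hx1 Em Eu. apply HX in Hx. apply HX in Hx'.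
    unfold m, u, c in *. simpl in *.
    apply (indiscernible_eq_diag B as_ _ Hlen Hind) in Eu. rewrite Ha in Eu.
    rewrite <- (Hc x0 Hx0 p Hx), <- (Hc x0 Hx0 p' Hx'), Em, Eu. reflexivity.
  (* An obstruction only involves divisibility of terms shifted by integers, which is the same for
     all tuples. It is therefore an obstruction over [a] alone, and then every element of the class
     solves one of finitely many equations. *)
  - destruct HW as [Hdd [_ Hzs]]. intros k Hk Hob. apply Hinf.
    apply finite_set_sub with (fun x => exists p, In p J /\ exists z, In z zs /\
      ((0 < coef 0 (fst p))%Z /\
       coef 0 (fst p) ⊙ x ⊕ teval U (env_x U 'O a) (fst p) = (N * z) ⊙ s1 U)).
    + intros x Hx. pose proof Hx as [_ [_ [_ [_ [y Hy]]]]].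
      destruct (obstructed_solution _ J (fun p => coef 0 (fst p)) snd N s HN zs
        (fun p => teval U (env_x U 'O a) (fst p)) k x y (Hzs k Hk) (Hdd k Hk))
        as [p [z [Hp [Hp1 [Hz Ez]]]]]; try assumption.
      * intros s' Hs'. destruct (Hob s' Hs') as [[i p] [Hp [Hp1 [Hp2 Hp3]]]].
        exists p. apply HX in Hp. unfold m, u, c in *. simpl in *.
        repeat split; try assumption.
        specialize (Hcol i (fst p) (k * N)%Z (coef 0 (fst p) * (N * s' + s))%Z).
        apply col_eq in Hcol. apply Hcol, Hp3.
      * apply Hc, Hx.
      * exists p. split; [exact Hp|]. exists z. auto.
    + apply finite_set_union. intros p _. apply finite_set_union. intros z _.
      destruct (Z_lt_le_dec 0 (coef 0 (fst p))) as [Hp|Hp].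
      * eapply finite_set_sub; [intros x [_ K]; exact K|]. apply finite_set_linear. lia.
      * exists []. intros x [K _]. lia.
  (* Over [as_ i] the terms at [x] have the colours they have over [a] at [x0], and these determine
     [phi]. *)
  - exists x. intros i Hi.
    apply (determined_colored N ts (fun v => sat U P v phi) J (env_x U x0 a)); try assumption.
    intros p Hp. rewrite teval_env_x. apply (Hx (i, p)). apply in_prod; assumption.
Qed.
End Zmodule.

(** * Transfer of additive randomness *)

Lemma nth_map_seq {T : Type} (v : nat -> T) a n i d :
  (i < n)%nat -> nth i (map v (seq a n)) d = v (a + i)%nat.
Proof.
  intros Hi. rewrite (nth_indep _ d (v 0%nat)) by (rewrite length_map, length_seq; exact Hi).
  rewrite map_nth, seq_nth by exact Hi. reflexivity.
Qed.

(** The integers of (P3) are values of closed terms, so the condition makes sense in [U] as well. *)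
Lemma elem_ext_numeral (M : Lstr) e : elem_ext M e ->
  forall z, e z = teval M (fun _ => s0 M) (tzmul z TOne).
Proof.
  intros E z.
  assert (K : sat M (noP M) (fun _ => e z) (FEq (TVar 0) (tzmul z TOne))).
  { apply (E (FEq (TVar 0) (tzmul z TOne)) I (fun _ => z)). simpl.
    rewrite !teval_tnmul, !nmul_Zstr. simpl. lia. }
  simpl in K. rewrite K, !teval_tnmul. simpl. rewrite !teval_tnmul. reflexivity.
Qed.

(** For fixed coefficients and a fixed number of excluded elements, randomness without [chi] is a
    first-order statement, so it passes from [M] to [U]. Infinitude becomes a solution outside any
    given list. *)
Lemma additively_random_transfer (M : Lstr) (e : Z -> M) (D : M -> Prop) (U : Lstr) PU :
  elem_ext M e -> additively_random M e D -> elem_equiv M D U PU -> Zgroup U ->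
  forall ms ms' : list Z,
  (forall m, In m ms -> (1 <= m)%Z) -> (forall m, In m ms' -> (1 <= m)%Z) ->
  exists dd zs, random_witness U PU ms ms' dd zs.
Proof.
  intros E HR EE HU ms ms' Hms Hms'.
  set (ns := map Z.to_nat ms). set (ns' := map Z.to_nat ms').
  assert (Hns : forall m, In m ns -> (1 <= m)%nat).
  { intros m Hm. apply in_map_iff in Hm. destruct Hm as [z [<- Hz]]. apply Hms in Hz. lia. }
  assert (Hns' : forall m, In m ns' -> (1 <= m)%nat).
  { intros m Hm. apply in_map_iff in Hm. destruct Hm as [z [<- Hz]]. apply Hms' in Hz. lia. }
  destruct (HR ns ns' Hns Hns') as [chi [dd [_ [Hdd [H12 H3]]]]].
  assert (Hzs : exists zs, forall k, In k dd -> forall x, D x -> scong M k 0 x ->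
     exists z, In z zs /\ x = e z).
  { clear - H3. induction dd as [|k dd IH].
    - exists []. intros k [].
    - destruct IH as [zs Hzs]; [intros; apply H3; simpl; auto|].
      destruct (H3 k (or_introl eq_refl)) as [l Hl].
      exists (l ++ zs). intros k' [<-|Hk] x Dx Cx.
      + destruct (Hl x Dx Cx) as [z [Hz Ez]]. exists z. rewrite in_app_iff. auto.
      + destruct (Hzs k' Hk x Dx Cx) as [z [Hz Ez]]. exists z. rewrite in_app_iff. auto. }
  destruct Hzs as [zs Hzs]. clear H3.
  exists (map Z.of_nat dd), zs. split; [|split].
  - intros k Hk. apply in_map_iff in Hk. destruct Hk as [n [<- Hn]]. apply Hdd in Hn. lia.
  - intros L L' HL HL' Hdis Hcong F.
    set (r := length ns). set (r' := length ns'). set (f := length F).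
    assert (Er : length L = r).
    { unfold r, ns. rewrite length_map, <- HL, length_map. reflexivity. }
    assert (Er' : length L' = r').
    { unfold r', ns'. rewrite length_map, <- HL', length_map. reflexivity. }
    (* Layout of variables: [r] constants of [L], [r'] constants of [L'], [f] excluded elements, and
       then [Y] for the solution. *)
    set (Y := (r + r' + f)%nat).
    set (lin := fun m i => TAdd (tnmul m (TVar Y)) (TVar i)).
    set (R1 := fun (S : Lstr) (P : S -> Prop) (v : nat -> S) =>
      (forall j, In j (seq 0 f) -> ~ teval S v (TVar Y) = teval S v (TVar (r + r' + j))) /\
      (forall i, In i (seq 0 r) -> P (teval S v (lin (nth i ns 0%nat) i))) /\
      (forall j, In j (seq 0 r') -> ~ P (teval S v (lin (nth j ns' 0%nat) (r + j)%nat)))).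
    set (R := fun (S : Lstr) (P : S -> Prop) (v : nat -> S) =>
      (forall i, In i (seq 0 r) -> forall j, In j (seq 0 r') -> nth i ns 0%nat = nth j ns' 0%nat ->
         ~ teval S v (TVar i) = teval S v (TVar (r + j))) ->
      (forall k, In k dd -> exists s, In s (seq 0 k) /\ forall i, In i (seq 0 r) ->
         ~ scong S k 0 (teval S v (TAdd (tnmul (nth i ns 0%nat * s) TOne) (TVar i)))) ->
      exists y, R1 S P (upd S v Y y)).
    assert (HRe : expressible false R).
    { apply expr_imp; [|apply expr_imp].
      - apply expr_all_in. intros i _. apply expr_all_in. intros j _.
        apply expr_imp; [apply expr_const|]. apply expr_not, expr_eq.
      - apply expr_all_in. intros k _. apply expr_ex_in. intros s _.
        apply expr_all_in. intros i _. apply expr_not, expr_cong.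
      - apply expr_ex. apply expr_and; [|apply expr_and].
        + apply expr_all_in. intros j _. apply expr_not, expr_eq.
        + apply expr_all_in. intros i _. apply expr_P.
        + apply expr_all_in. intros j _. apply expr_not, expr_P. }
    assert (Hlin : forall (S : Lstr) (v : nat -> S) y m i, (i < Y)%nat ->
      teval S (upd S v Y y) (lin m i) = sadd S (nmul S m y) (v i)).
    { intros S v y m i Hi. unfold lin. simpl. rewrite teval_tnmul. simpl. unfold upd.
      rewrite Nat.eqb_refl. destruct (Nat.eqb_spec i Y); [lia|reflexivity]. }
    assert (HM : forall v : nat -> M, (forall i, (Y <= i)%nat -> v i = s0 M) -> R M D v).
    { intros v _ Hd Hc.
      set (b := map v (seq 0 r)). set (b' := map v (seq r r')).
      assert (Hb : forall i, (i < r)%nat -> nth i b (s0 M) = v i).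
      { intros i Hi. apply (nth_map_seq v 0 r i _ Hi). }
      assert (Hb' : forall j, (j < r')%nat -> nth j b' (s0 M) = v (r + j)%nat).
      { intros j Hj. apply (nth_map_seq v r r' j _ Hj). }
      destruct (H12 b b') as [Hchi Hnchi].
      - unfold b. rewrite length_map, length_seq. reflexivity.
      - unfold b'. rewrite length_map, length_seq. reflexivity.
      - fold r r'. intros i j Hi Hj K. rewrite Hb, Hb' in K by assumption.
        injection K as K1 K2.
        apply (Hd i ltac:(apply in_seq; lia) j ltac:(apply in_seq; lia) K1). exact K2.
      (* If [chi] holds, a failure would make the excluded elements exhaust an infinite set. If it
         fails, (P2) contradicts the assumed absence of obstructions. *)
      - destruct (classic (sat M (noP M) (env_list M (b ++ b')) chi)) as [C|C].
        + apply NNPP. intros Hn. apply (Hchi C).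
          exists (map v (seq (r + r') f)). intros y [Hy1 Hy2].
          apply NNPP. intros Hy. apply Hn. exists y. split; [|split].
          * intros j Hj Ej. apply in_seq in Hj. apply Hy.
            simpl in Ej. unfold upd in Ej. rewrite Nat.eqb_refl in Ej.
            destruct (Nat.eqb_spec (r + r' + j) Y); [unfold Y in *; lia|].
            rewrite Ej. apply in_map, in_seq. lia.
          * intros i Hi. apply in_seq in Hi. rewrite Hlin by (unfold Y; lia).
            rewrite <- Hb by lia. apply Hy1. fold r. lia.
          * intros j Hj. apply in_seq in Hj. rewrite Hlin by (unfold Y; lia).
            rewrite <- Hb' by lia. apply Hy2. fold r'. lia.
        + exfalso. destruct (Hnchi C) as [_ [k [Hk Hs]]].
          destruct (Hc k Hk) as [s [Hs1 Hs2]]. apply in_seq in Hs1.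
          destruct (Hs s) as [i [Hi Ci]]; [lia|]. fold r in Hi.
          apply (Hs2 i); [apply in_seq; lia|]. simpl. rewrite teval_tnmul.
          rewrite Hb in Ci by exact Hi. exact Ci. }
    set (d := (0%Z, s0 U)).
    set (v := env_list U (map snd L ++ map snd L' ++ F)).
    assert (Hv : forall i, (i < r)%nat -> v i = snd (nth i L d)).
    { intros i Hi. unfold v, env_list. rewrite app_nth1 by (rewrite length_map; lia).
      change (s0 U) with (snd d). apply map_nth. }
    assert (Hv' : forall j, (j < r')%nat -> v (r + j)%nat = snd (nth j L' d)).
    { intros j Hj. unfold v, env_list. rewrite app_nth2 by (rewrite length_map; lia).
      rewrite app_nth1 by (rewrite !length_map; lia). rewrite length_map, Er.
      replace (r + j - r)%nat with j by lia. change (s0 U) with (snd d). apply map_nth. }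
    assert (Hv2 : forall j, (j < f)%nat -> v (r + r' + j)%nat = nth j F (s0 U)).
    { intros j Hj. unfold v, env_list. rewrite app_nth2 by (rewrite length_map; lia).
      rewrite app_nth2 by (rewrite !length_map; lia). rewrite !length_map, Er, Er'.
      f_equal. lia. }
    assert (Hn : forall i, nth i ns 0%nat = Z.to_nat (fst (nth i L d))).
    { intros i. unfold ns. rewrite <- HL, map_map.
      exact (map_nth (fun x => Z.to_nat (fst x)) L d i). }
    assert (Hn' : forall i, nth i ns' 0%nat = Z.to_nat (fst (nth i L' d))).
    { intros i. unfold ns'. rewrite <- HL', map_map.
      exact (map_nth (fun x => Z.to_nat (fst x)) L' d i). }
    assert (Hp : forall p, In p L -> (1 <= fst p)%Z).
    { intros p Hp. apply Hms. rewrite <- HL. apply in_map, Hp. }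
    assert (Hp' : forall p, In p L' -> (1 <= fst p)%Z).
    { intros p Hp'. apply Hms'. rewrite <- HL'. apply in_map, Hp'. }
    destruct (elem_equiv_expr M D U PU Y R EE HRe HM v) as [y [Hy1 [Hy2 Hy3]]].
    + intros i Hi. apply nth_overflow. rewrite !length_app, !length_map.
      unfold Y, f in Hi. lia.
    + intros i Hi j Hj K1 K2. apply in_seq in Hi. apply in_seq in Hj. simpl in K2.
      rewrite Hv, Hv' in K2 by lia. rewrite Hn, Hn' in K1.
      assert (I1 : In (nth i L d) L) by (apply nth_In; lia).
      assert (I2 : In (nth j L' d) L') by (apply nth_In; lia).
      apply (Hdis _ I1). replace (nth i L d) with (nth j L' d); [exact I2|].
      pose proof (Hp _ I1). pose proof (Hp' _ I2).
      destruct (nth i L d) as [z1 x1], (nth j L' d) as [z2 x2]. simpl in *.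
      f_equal; [lia|congruence].
    + intros k Hk. destruct (Hcong (Z.of_nat k)) as [s [Hs1 Hs2]]; [apply in_map, Hk|].
      apply in_zrange in Hs1. exists (Z.to_nat s). split; [apply in_seq; lia|].
      intros i Hi C. apply in_seq in Hi. apply scong_zdvd in C; [|exact HU|exact (Hdd k Hk)].
      assert (I1 : In (nth i L d) L) by (apply nth_In; lia).
      apply (Hs2 _ I1). simpl in C. rewrite teval_tnmul, Hv, Hn in C by lia.
      rewrite (nmul_zmul U HU), Nat2Z.inj_mul, !Z2Nat.id in C; [exact C|lia|].
      specialize (Hp _ I1). lia.
    + exists y. split; [|split].
      * intros HyF. apply (In_nth _ _ (s0 U)) in HyF. destruct HyF as [j [Hj Ej]].
        apply (Hy1 j); [apply in_seq; unfold f; lia|]. simpl. unfold upd.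
        rewrite Nat.eqb_refl. destruct (Nat.eqb_spec (r + r' + j) Y); [unfold Y, f in *; lia|].
        rewrite Hv2 by exact Hj. congruence.
      * intros p HpL. pose proof HpL as Hi. apply (In_nth _ _ d) in Hi.
        destruct Hi as [i [Hi Ei]].
        specialize (Hy2 i ltac:(apply in_seq; lia)).
        rewrite Hlin, Hv, Hn, Ei, (nmul_zmul U HU), Z2Nat.id in Hy2;
          [exact Hy2|specialize (Hp _ HpL); lia|lia|unfold Y; lia].
      * intros p HpL. pose proof HpL as Hi. apply (In_nth _ _ d) in Hi.
        destruct Hi as [i [Hi Ei]].
        specialize (Hy3 i ltac:(apply in_seq; lia)).
        rewrite Hlin, Hv', Hn', Ei, (nmul_zmul U HU), Z2Nat.id in Hy3;
          [exact Hy3|specialize (Hp' _ HpL); lia|lia|unfold Y; lia].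
  - intros k Hk x Px Kx. apply in_map_iff in Hk. destruct Hk as [n [<- Hn]].
    apply (scong_zdvd U HU n x (Hdd n Hn)) in Kx.
    (* For fixed [n] this is (P3) as a sentence: [zs] is a fixed finite list, so it is a finite
       disjunction of equations with closed terms. *)
    pose proof (elem_equiv_expr M D U PU 1 (fun S P v => P (teval S v (TVar 0)) ->
      scong S n 0 (teval S v (TVar 0)) ->
      exists z, In z zs /\ teval S v (TVar 0) = teval S v (tzmul z TOne)) EE) as T.
    destruct (fun H1 H2 => T H1 H2 (env_list U [x])) as [z [Hz Ez]]; try assumption.
    + apply expr_imp; [apply expr_P|]. apply expr_imp; [apply expr_cong|].
      apply expr_ex_in. intros z _. apply expr_eq.
    + intros v _ Dv Cv. destruct (Hzs n Hn _ Dv Cv) as [z [Hz Ez]].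
      exists z. split; [exact Hz|]. rewrite Ez, (elem_ext_numeral M e E).
      unfold tzmul. simpl. rewrite !teval_tnmul. reflexivity.
    + intros i Hi. apply nth_overflow. exact Hi.
    + exists z. split; [exact Hz|].
      exact (eq_trans Ez (teval_tzmul U (env_list U [x]) z TOne)).
Qed.

Lemma symmetric_transfer (M : Lstr) (D : M -> Prop) (U : Lstr) (PU : U -> Prop) :
  symmetric_set M D -> elem_equiv M D U PU -> symmetric_set U PU.
Proof.
  intros HS EE x.
  pose proof (expr_P (TVar 0)) as C. pose proof (expr_P (TNeg (TVar 0))) as C'.
  refine (elem_equiv_expr M D U PU 1 _ EE (expr_and false _ _ (expr_imp false _ _ C C')
    (expr_imp false _ _ C' C)) _ (env_list U [x]) _).
  - intros v _. apply HS.
  - intros i Hi. apply nth_overflow. exact Hi.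
Qed.

Theorem theorem3p3 :
  forall (M : Lstr) (e : Z -> M) (D : M -> Prop),
    elem_ext M e ->
    symmetric_set M D ->
    additively_random M e D ->
    forall (U : Lstr) (PU : U -> Prop),
      elem_equiv M D U PU ->
      forall (B : U -> Prop) (phi : form) (a : list U),
        divides U PU B phi a -> algebraic U PU phi a.
Proof.
  intros M e D E HS HR U PU EE B phi a.
  pose proof (Zgroup_transfer M e D U PU E EE) as HU.
  apply (divides_algebraic U HU PU).
  - exact (symmetric_transfer M D U PU HS EE).
  - exact (additively_random_transfer M e D U PU E HR EE HU).
Qed.
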